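(* Suppose $\rho<1$. Then for any $\epsilon>0$ there exist $\bar\alpha_\epsilon,\bar\beta_\epsilon>0$ such that for all $0<\alpha\le\bar\alpha_\epsilon$ and $0<\beta\le\bar\beta_\epsilon$ (with $\alpha\in(0,1)$), in the game with payoffs $\mathcal M_i(\cdot;\beta,\alpha)$: (1) if $\rho\le f(\phi_b)/2$, the pure profile $(f^{-1}(2\rho),f^{-1}(2\rho))$ is an $\epsilon$-Nash equilibrium; and if $f(\phi_b)/2<\rho<1$, the mixed profile $(\sigma^*,\sigma^* )$ is an $\epsilon$-Nash equilibrium; (2) if $f(\phi_b)/2<\rho<1$, the interval $[\phi_L^*,\phi_R^*]$ is an $\epsilon$-equilibrium cycle.
   Context: Fix $\phi_h>0$ and $f:[0,\phi_h]\to\mathbb R$ strictly concave, strictly decreasing and differentiable, with $0<f(\phi)\le 1$ for all $\phi$ and $f(0)=1$. Fix $\Lambda>0$, $e>0$, $\rho:=e/\Lambda$, and a positive integer $\bar N$. The extended inverse $f^{-1}:[0,\infty)\to[0,\phi_h]$: $f^{-1}(x)=\phi_h$ for $0\le x<f(\phi_h)$; the unique $\phi$ with $f(\phi)=x$ for $f(\phi_h)\le x\le1$; $0$ for $x>1$. Game for $\beta>0$, $\alpha\in(0,1)$: two platforms choose prices $\phi_i\in[0,\phi_h]$. For $\phi\in[0,\phi_h]$, $\lambda\in[0,\Lambda]$ let $\mu_n=\mu_n(\phi,\lambda;\beta)=\prod_{a=1}^n\frac{e}{\lambda f(\phi)+a\beta}$ (so $\mu_0=1$), $\mathcal U(\phi,\lambda;\beta)=\big(\sum_{n\ge0}\mu_n\big)^{-1}$,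 and $$\mathcal D(\phi,\lambda;\beta,\alpha)=1-f(\phi)+f(\phi)\,\mathcal U(\phi,\lambda;\beta)+\alpha f(\phi)\frac{\sum_{n=1}^{\bar N}\mu_n/n}{\sum_{n=0}^\infty\mu_n}.$$ For $(\phi_1,\phi_2)$, the Wardrop split is $\lambda_1=$ the (unique) minimizer over $\lambda\in[0,\Lambda]$ of $(\mathcal D(\phi_1,\lambda;\beta,\alpha)-\mathcal D(\phi_2,\Lambda-\lambda;\beta,\alpha))^2$ and $\lambda_2=\Lambda-\lambda_1$. Payoffs: $\mathcal M_i(\phi_1,\phi_2;\beta,\alpha)=\lambda_i f(\phi_i)\phi_i(1-\mathcal U(\phi_i,\lambda_i;\beta))$. Mixed strategies are Borel probability measures on $[0,\phi_h]$, with payoffs extended by expectation under independent play. Let $\phi_b:=\max\{\phi\in[0,\phi_h]: f(\phi)+2\phi f'(\phi)\ge0\}$. Let $\phi_L^*$ and $\phi_R^*$ be respectively the maximum value and the maximizer over $[0,\phi_h]$ of $\phi\mapsto(f(\phi)-\rho)\phi/\rho$. When $f(\phi_b)/2<\rho<1$, $\sigma^*$ is the probability measure supported on $[\phi_L^*,\phi_R^*]$ with $$\sigma^*([\phi_L^*,\phi])=\frac{e(\phi+\phi_R^* )-\Lambda f(\phi_R^* )\phi_R^*}{2e\phi-\Lambda f(\phi)\phi},\qquad \phi\in[\phi_L^*,\phi_R^*].$$ A (pure or mixed) profile $\sigma$ is an $\epsilon$-Nash equilibrium if $\mathcal M_i(\phi_i,\sigma_{-i})\le\mathcal M_i(\sigma_i,\sigma_{-i})+\epsilon$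 for every $i$ and every $\phi_i\in[0,\phi_h]$. A closed interval $[a,b]$ is an $\epsilon$-equilibrium cycle if (i) for any $i\in\{1,2\}$ and $\phi_{-i}\in[a+\epsilon,b-\epsilon]$ there exists $\phi_i\in[a,b]$ such that $\mathcal M_i(\phi_i,\phi_{-i})>\mathcal M_i(\tilde\phi_i,\phi_{-i})$ for all $\tilde\phi_i\in[0,\phi_h]\setminus[a-\epsilon,b+\epsilon]$; (ii) for any $(\phi_1,\phi_2)\in[a+\epsilon,b-\epsilon]^2$ there exist $i\in\{1,2\}$ and $\phi_i'\in[a,b]$ such that $\mathcal M_i(\phi_i',\phi_{-i})>\mathcal M_i(\phi_i,\phi_{-i})$ and $\mathcal M_i(\phi_i',\phi_{-i})>\mathcal M_i(\tilde\phi_i,\phi_{-i})$ for all $\tilde\phi_i\in[0,\phi_h]\setminus[a-\epsilon,b+\epsilon]$; (iii) there exists no subset $[c,d]$ of $[a+\epsilon,b-\epsilon]$ that satisfies conditions (i)-(ii) (that is, with $[c,d]$ in the place of $[a,b]$). Here $\mathcal M_i=\mathcal M_i(\cdot;\beta,\alpha)$ and $-i$ is the other player.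
   Formalization: In clause (iii), the excluded subintervals [c,d] of [a+ε,b−ε] are those satisfying (i)-(ii) with ε replaced by 0; with the same ε, every one-point interval [c,c] satisfies (i)-(ii) vacuously, so part (2) would be false for small ε. *)

(* Defs.v *)
From HB Require Import structures.
From mathcomp Require Import all_boot all_order all_algebra.
From mathcomp Require Import all_classical all_reals all_analysis.

Set Implicit Arguments.
Unset Strict Implicit.
Unset Printing Implicit Defensive.

Import Order.TTheory GRing.Theory Num.Theory.
Import numFieldNormedType.Exports.

Local Open Scope classical_set_scope.
Local Open Scope ring_scope.

Section Optimum.
Variable R : realType.
Implicit Types (A : set R) (g : R -> R).

(* These three pick the element with the stated property (0 when there is
   none). *)
Definition max_of A : R := xget 0 [set m | A m /\ ubound A m].

Definition argmax A g : R :=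
  xget 0 [set x | A x /\ forall y, A y -> g y <= g x].

Definition argmin A g : R :=
  xget 0 [set x | A x /\ forall y, A y -> g x <= g y].

End Optimum.

Section Derivative.
Variable R : realType.
Implicit Types (A : set R) (f : R -> R) (x : R).

Definition diff_quotient f x : R -> R := fun y => (f y - f x) / (y - x).

(* The limit is taken along points of A only; for A = [0, phih] this gives the
   one-sided derivative at the two endpoints. *)
Definition derivable_in A f x : Prop :=
  cvg (diff_quotient f x @ within A x^').

Definition derive_in A f x : R := lim (diff_quotient f x @ within A x^').

End Derivative.

Definition strictly_concave_in (R : realType) (A : set R) (f : R -> R) : Prop :=
  forall x y t : R, A x -> A y -> x != y -> 0 < t < 1 ->
    t * f x + (1 - t) * f y < f (t * x + (1 - t) * y).

Inductive platform := platform1 | platform2.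

Definition other (i : platform) : platform :=
  match i with platform1 => platform2 | platform2 => platform1 end.

Section Model.
Variables (R : realType) (phih : R) (f : R -> R) (Lam e : R) (Nbar : nat).

Section Payoff.
Variables beta alpha : R.

Definition mu (phi lam : R) (n : nat) : R :=
  \prod_(1 <= a < n.+1) (e / (lam * f phi + a%:R * beta)).

Definition mu_total (phi lam : R) : R := limn (series (mu phi lam)).

Definition calU (phi lam : R) : R := (mu_total phi lam)^-1.

Definition calD (phi lam : R) : R :=
  1 - f phi + f phi * calU phi lam
  + alpha * f phi
    * ((\sum_(1 <= n < Nbar.+1) mu phi lam n / n%:R) / mu_total phi lam).

Definition wardrop1 (phi1 phi2 : R) : R :=
  argmin `[0, Lam]
    (fun lam => (calD phi1 lam - calD phi2 (Lam - lam)) ^+ 2).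

Definition wardrop (i : platform) (phi1 phi2 : R) : R :=
  match i with
  | platform1 => wardrop1 phi1 phi2
  | platform2 => Lam - wardrop1 phi1 phi2
  end.

Definition calM (i : platform) (phi1 phi2 : R) : R :=
  let phi := match i with platform1 => phi1 | platform2 => phi2 end in
  let lam := wardrop i phi1 phi2 in
  lam * f phi * phi * (1 - calU phi lam).

End Payoff.

(* The extended inverse of f. *)
Definition ext_inverse (x : R) : R :=
  if x < f phih then phih
  else if x <= 1 then xget 0 [set phi | `[0, phih]%classic phi /\ f phi = x]
  else 0.

Definition phi_b : R :=
  max_of [set phi | `[0, phih]%classic phi /\
                    0 <= f phi + 2 * phi * derive_in `[0, phih] f phi].

Definition residual (phi : R) : R := (f phi - e / Lam) * phi / (e / Lam).

Definition phi_L : R := max_of (residual @` `[0, phih]).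

Definition phi_R : R := argmax `[0, phih] residual.

Definition is_sigma_star (sigma : probability (measurableTypeR R) R) : Prop :=
  sigma `[phi_L, phi_R]%classic = 1%E /\
  forall phi, `[phi_L, phi_R]%classic phi ->
    sigma `[phi_L, phi]%classic =
      ((e * (phi + phi_R) - Lam * f phi_R * phi_R)
       / (2 * e * phi - Lam * f phi * phi))%:E.

End Model.

Section Game.
Variables (R : realType) (phih : R) (M : platform -> R -> R -> R).

Definition prices : set R := `[0, phih]%classic.

(* M_i(x, phi_{-i}): the first argument is the price of player i itself, the
   second that of the other player. *)
Definition own (i : platform) (x y : R) : R :=
  match i with platform1 => M i x y | platform2 => M i y x end.

Definition pure_eps_nash (eps : R) (s : platform -> R) : Prop :=
  (forall i, prices (s i)) /\
  forall i x, prices x ->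
    own i x (s (other i)) <= own i (s i) (s (other i)) + eps.

Definition mixed_strategy (sigma : probability (measurableTypeR R) R) : Prop :=
  sigma prices = 1%E.

Definition mixed_payoff (i : platform)
    (s : platform -> probability (measurableTypeR R) R) : \bar R :=
  (\int[(s platform1 \x s platform2)%E]_(p in prices `*` prices)
     (M i p.1 p.2)%:E)%E.

(* M_i(x, sigma_{-i}), with tau the mixed strategy of the other player. *)
Definition deviation_payoff (i : platform) (x : R)
    (tau : probability (measurableTypeR R) R) : \bar R :=
  (\int[tau]_(y in prices) (own i x y)%:E)%E.

Definition mixed_eps_nash (eps : R)
    (s : platform -> probability (measurableTypeR R) R) : Prop :=
  (forall i, mixed_strategy (s i)) /\
  forall i x, prices x ->
    (deviation_payoff i x (s (other i)) <= mixed_payoff i s + eps%:E)%E.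

(* x is a better reply to y than every price outside [a - eps, b + eps]. *)
Definition beats_outside (eps a b : R) (i : platform) (x y : R) : Prop :=
  forall z, prices z -> ~ `[a - eps, b + eps]%classic z ->
    own i z y < own i x y.

Definition cycle_i (eps a b : R) : Prop :=
  forall (i : platform) (y : R), `[a + eps, b - eps]%classic y ->
    exists x, `[a, b]%classic x /\ beats_outside eps a b i x y.

Definition cycle_ii (eps a b : R) : Prop :=
  forall s : platform -> R,
    (forall i, `[a + eps, b - eps]%classic (s i)) ->
    exists i x, [/\ `[a, b]%classic x,
      own i (s i) (s (other i)) < own i x (s (other i)) &
      beats_outside eps a b i x (s (other i))].

(* The last clause excludes subintervals [c, d] of [a + eps, b - eps] that
   satisfy the two conditions exactly, without tolerance: the tolerance is
   spent on shrinking the range of [c, d].  Keeping eps there as well would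
   make the clause unsatisfiable as soon as a + eps <= b - eps, since both
   conditions hold vacuously for a degenerate [c, c] with eps > 0.  In this
   form all three clauses relax their eps = 0 versions. *)
Definition eps_equilibrium_cycle (eps a b : R) : Prop :=
  [/\ 0 <= a, a <= b & b <= phih] /\
  [/\ cycle_i eps a b, cycle_ii eps a b &
      ~ exists c d, [/\ c <= d,
          `[c, d] `<=` `[a + eps, b - eps], cycle_i 0 c d & cycle_ii 0 c d]].

End Game.

(* Main.v *)
Require Import Defs.
From HB Require Import structures.
From mathcomp Require Import all_boot all_order all_algebra.
From mathcomp Require Import all_classical all_reals all_analysis.
From mathcomp Require Import measurable_realfun ring lra.

Set Implicit Arguments.
Unset Strict Implicit.
Unset Printing Implicit Defensive.

Import Order.TTheory GRing.Theory Num.Theory.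
Import numFieldNormedType.Exports.

Local Open Scope classical_set_scope.
Local Open Scope ring_scope.

(* As alpha, beta -> 0 the fraction of idle time of a platform with load
   t = lam f(phi) tends, uniformly in t, to max(0, 1 - e / t).  In the limit game a
   platform charging x earns e x when it undercuts its opponent and
   e r(x) = x (Lam f(x) - e) when it is undercut (once f < 2 rho), where r is
   [residual]; the limit is discontinuous only at equal prices.

   Strict concavity of f forces f(y) - f(x) >= 1 - f(d) whenever x >= y + d, so the
   limit payoffs are reached uniformly over all pairs of prices at distance at least
   d.  The Wardrop split is only used through its first-order conditions.

   - Below the threshold rho <= f(phi_b) / 2, r is at most p = f^-1(2 rho) beyond p,
     and a deviation within d of p gains at most e d.
   - Above it, the distribution function of sigma* is F = (x - phi_L) / (x - r(x)),
     that is r F + x (1 - F) = phi_L: every price in [phi_L, phi_R] earns e phi_L.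
     F is Lipschitz because x - r(x) increases there, so pairs of prices within d of
     each other have small probability.
   - For the cycle, the reply y - d to y beats every price above y, and every price
     at most phi_L: an opponent close above y shares the demand, and its load is at
     most half of Lam f(y) < 2 e. *)

(** * The queue of a platform *)

(** Two facts replace any passage to the limit. By optimality of the split, a platform with positive
    demand accepts at least as large a fraction of it as its rival, where [f * (1 - score)] is that
    fraction; and an underloaded platform accepts nearly the fraction [f]. So a clearly cheaper
    rival must be overloaded before the dearer platform [x] receives anything. Being overloaded it
    serves nearly [e], and its acceptance is then at most [f x], so it holds a demand of at least
    about [e / f x]. What is left is worth [x * (Lam * f x - e)]: this is the origin of [residual].
    The threshold is the sign of the slope of [r] at [p]: if [f p = 2 * rho], then [r p = p] and
    [r' p = (f p + 2 * p * f' p) / (2 * rho)]. The order of choices matters. The distance [d]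
    depends on [eps] and the demand data; then [alpha + delta < 1 - f d] separates prices [d] apart,
    and [beta] is bounded last. Payoffs are not shown to be measurable, so expectations are compared
    with those of explicit measurable functions. *)

(* [t] stands for the load [lam * f phi]; [nu t], [nu_total t] and [idle t] are
   then [mu], [mu_total] and [calU], and [calD = 1 - f * (1 - score)]. *)
Section Queue.
Variables (R : realType) (e beta : R).
Hypotheses (e_gt0 : 0 < e) (beta_gt0 : 0 < beta).
Implicit Types (s t alpha : R) (n N M K : nat).

Definition nu t n : R := \prod_(1 <= a < n.+1) (e / (t + a%:R * beta)).
Definition nu_total t : R := limn (series (nu t)).
Definition idle t : R := (nu_total t)^-1.
Definition score_num alpha N t : R := 1 + alpha * \sum_(1 <= n < N.+1) nu t n / n%:R.
Definition score alpha N t : R := score_num alpha N t / nu_total t.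

Lemma nu0 t : nu t 0 = 1.
Proof. by rewrite /nu big_geq. Qed.

Lemma nu_rate_gt0 t n : 0 <= t -> 0 < t + n.+1%:R * beta.
Proof. by move=> t0; rewrite ltr_wpDl// mulr_gt0. Qed.

Lemma nuS t n : nu t n.+1 = nu t n * (e / (t + n.+1%:R * beta)).
Proof. by rewrite /nu big_nat_recr. Qed.

Lemma nuSM t n : 0 <= t -> nu t n.+1 * (t + n.+1%:R * beta) = e * nu t n.
Proof.
move=> t0; rewrite nuS -mulrA divfK ?gt_eqF ?nu_rate_gt0//.
by rewrite mulrC.
Qed.

Lemma nu_gt0 t n : 0 <= t -> 0 < nu t n.
Proof.
move=> t0; elim: n => [|n IH]; first by rewrite nu0.
by rewrite nuS mulr_gt0// divr_gt0// nu_rate_gt0.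
Qed.

Lemma nu_ge0 t n : 0 <= t -> 0 <= nu t n.
Proof. by move=> t0; rewrite ltW// nu_gt0. Qed.

Lemma rate_le s t n : 0 <= s -> s <= t ->
  e / (t + n.+1%:R * beta) <= e / (s + n.+1%:R * beta).
Proof.
move=> s0 st; rewrite ler_pM2l// lef_pV2 ?lerD2r// posrE nu_rate_gt0//.
exact: le_trans st.
Qed.

Lemma rate_gt0 t n : 0 <= t -> 0 < e / (t + n.+1%:R * beta).
Proof. by move=> t0; rewrite divr_gt0// nu_rate_gt0. Qed.

Lemma nu_le s t n : 0 <= s -> s <= t -> nu t n <= nu s n.
Proof.
move=> s0 st; elim: n => [|n IH]; first by rewrite !nu0.
have t0 := le_trans s0 st.
by rewrite !nuS ler_pM ?rate_le ?nu_ge0// ltW// rate_gt0.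
Qed.

(** Without load the weights are exponential coefficients; as [nu] decreases in the load, this
    single series dominates all the others. *)
Lemma nu_at0 n : nu 0 n = exp_coeff (e / beta) n.
Proof.
elim: n => [|n IH]; first by rewrite nu0 /exp_coeff /= expr0 fact0 divr1.
rewrite nuS IH /exp_coeff /= exprS factS natrM add0r !invfM.
by rewrite -!mulrA; ring.
Qed.

Lemma cvg_nu t : 0 <= t -> cvgn (series (nu t)).
Proof.
move=> t0; apply: (@series_le_cvg _ _ (exp_coeff (e / beta))) => [n|n|n|].
- exact: nu_ge0.
- by apply: exp_coeff_ge0; rewrite divr_ge0// ltW.
- by rewrite -nu_at0 nu_le.
- exact: is_cvg_series_exp_coeff.
Qed.

Lemma series_nu_le t n : 0 <= t -> series (nu t) n <= nu_total t.
Proof.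
move=> t0; apply: nondecreasing_cvgn_le; last exact: cvg_nu.
by apply: nondecreasing_series => k _ _; exact: nu_ge0.
Qed.

Lemma series_nu_ge0 t n : 0 <= t -> 0 <= series (nu t) n.
Proof. by move=> t0; apply: sumr_ge0 => i _; exact: nu_ge0. Qed.

Lemma nu_total_le t c : 0 <= t -> (forall n, series (nu t) n <= c) -> nu_total t <= c.
Proof.
move=> t0 H; apply: limr_le; first exact: cvg_nu.
by apply: nearW.
Qed.

Lemma seriesnuS t n : series (nu t) n.+1 = series (nu t) n + nu t n.
Proof. by rewrite /series /= big_nat_recr. Qed.

Lemma seriesnu0 t : series (nu t) 0 = 0.
Proof. by rewrite /series /= big_geq. Qed.

Lemma nu_total_ge1 t : 0 <= t -> 1 <= nu_total t.
Proof.
by move=> t0; have := series_nu_le 1 t0; rewrite seriesnuS seriesnu0 nu0 add0r.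
Qed.

Lemma nu_total_gt0 t : 0 <= t -> 0 < nu_total t.
Proof. by move=> t0; rewrite (lt_le_trans ltr01)// nu_total_ge1. Qed.

Lemma nu_total_decr s t : 0 <= s -> s <= t -> nu_total t <= nu_total s.
Proof.
move=> s0 st; apply: nu_total_le; first exact: le_trans st.
move=> n; apply: le_trans (series_nu_le n s0).
by apply: ler_sum => k _; exact: nu_le.
Qed.

(** Strictness may be lost in a limit, so the gap at state 1 is carried through all partial sums. *)
Lemma nu_total_strict_decr s t : 0 <= s -> s < t -> nu_total t < nu_total s.
Proof.
move=> s0 st; have t0 : 0 <= t := le_trans s0 (ltW st).
have d0 : nu t 1 < nu s 1.
  rewrite !nuS !nu0 !mul1r ltr_pM2l// ltf_pV2 ?posrE ?nu_rate_gt0// ?ltrD2r//.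
    exact: ltr_wpDl.
  exact: ltr_wpDl.
have H n : series (nu t) n.+2 + (nu s 1 - nu t 1) <= series (nu s) n.+2.
  elim: n => [|n IH]; first by rewrite !seriesnuS !seriesnu0 !nu0; lra.
  rewrite seriesnuS (seriesnuS s); have := nu_le n.+2 s0 (ltW st).
  move: IH d0; set a := series (nu t) _; set b := series (nu s) _; lra.
suff : nu_total t <= nu_total s - (nu s 1 - nu t 1) by lra.
apply: nu_total_le => // n; have := H n; have := series_nu_le n.+2 s0.
by rewrite !seriesnuS; have := nu_ge0 n t0; have := nu_ge0 n.+1 t0; lra.
Qed.

Lemma idle_gt0 t : 0 <= t -> 0 < idle t.
Proof. by move=> t0; rewrite invr_gt0 nu_total_gt0. Qed.

(** [nu] holds the stationary weights of a birth-death chain with birth rate [e] and death rate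
    [t + n beta] in state [n]. Dropping the [beta] part of the balance equations and summing leaves
    [t (Z - 1) <= e Z], with [Z] the total weight. *)
Lemma served_le t : 0 <= t -> t * (1 - idle t) <= e.
Proof.
move=> t0; have Z0 := nu_total_gt0 t0.
have H n : t * (series (nu t) n.+1 - 1) <= e * series (nu t) n.
  elim: n => [|n IH]; first by rewrite seriesnuS seriesnu0 nu0 add0r subrr !mulr0.
  move: IH; rewrite (seriesnuS t n.+1) (seriesnuS t n).
  have := nuSM n t0; have : 0 <= n.+1%:R * beta * nu t n.+1.
    by rewrite mulr_ge0 ?nu_ge0// mulr_ge0// ltW.
  lra.
suff : t * (nu_total t - 1) <= e * nu_total t.
  by rewrite /idle => h; rewrite -(ler_pM2r Z0) -mulrA mulrBl mul1r mulVf ?gt_eqF.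
have [->|tn0] := eqVneq t 0; first by rewrite mul0r mulr_ge0// ltW// nu_total_gt0.
have tp : 0 < t by rewrite lt_neqAle eq_sym tn0.
rewrite -ler_pdivlMl// lerBlDr; apply: nu_total_le => // n.
have := H n; rewrite -ler_pdivlMl// lerBlDr => h.
apply: (@le_trans _ _ (series (nu t) n.+1)).
  by rewrite seriesnuS lerDl nu_ge0.
apply: le_trans h _; rewrite lerD2r ler_pM2l ?invr_gt0// ler_pM2l//.
exact: series_nu_le.
Qed.

Lemma nu_overload_decr t n K : e <= t -> (n <= K)%N -> nu t K <= nu t n.
Proof.
move=> et /subnK <-; have t0 : 0 <= t by rewrite (le_trans _ et)// ltW.
elim: (K - n)%N => // k IH; apply: le_trans IH; rewrite addSn nuS.
rewrite ler_piMr ?nu_ge0// ler_pdivrMr ?nu_rate_gt0// mul1r.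
by rewrite (le_trans et)// lerDl mulr_ge0// ltW.
Qed.

(* Sum of the balance equations [e p_(n-1) = (t + n beta) p_n] over the first
   [K] states, where [p_K <= 1 / (K + 1)] because [p] decreases for [e <= t]. *)
Lemma idle_overload t K : e <= t ->
  t * idle t <= t - e + (beta * K%:R + e / K.+1%:R).
Proof.
move=> et; have t0 : 0 <= t by rewrite (le_trans _ et)// ltW.
have Z0 := nu_total_gt0 t0.
have balance k : (k <= K)%N ->
    e * series (nu t) k - t * (series (nu t) k.+1 - 1)
      <= beta * K%:R * (series (nu t) k.+1 - 1).
  elim: k => [|k IH] kK.
    by rewrite seriesnuS seriesnu0 nu0 add0r subrr !mulr0 subr0.
  have := IH (ltnW kK); rewrite (seriesnuS t k.+1) (seriesnuS t k).
  have := nuSM k t0; have := nu_ge0 k.+1 t0.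
  have : k.+1%:R <= K%:R :> R by rewrite ler_nat.
  set S := series _ _; set v := nu t k; set w := nu t k.+1.
  move=> kK' w0 E h.
  have : beta * k.+1%:R * w <= beta * K%:R * w by rewrite ler_wpM2r// ler_pM2l.
  lra.
have nuK : K.+1%:R * nu t K <= nu_total t.
  apply: le_trans (series_nu_le K.+1 t0); rewrite mulr_natl.
  have : (K <= K)%N by [].
  rewrite /series /= big_mkord -[X in nu _ _ *+ X]card_ord -sumr_const => _.
  by apply: ler_sum => i _; apply: nu_overload_decr => //; rewrite -ltnS.
rewrite /idle ler_pdivrMr//.
have S1 := balance K (leqnn K).
have S2 := series_nu_le K.+1 t0; rewrite seriesnuS in S1 S2.
have nuK' : e * nu t K <= e / K.+1%:R * nu_total t.
  by rewrite -mulrA ler_pM2l// ler_pdivlMl.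
move: S1 S2 nuK'; set q := e / _; set b := beta * K%:R.
have b0 : 0 <= b by rewrite mulr_ge0// ltW.
set Q := series _ _ + _ => S1 S2 nuK'.
have : 0 <= (t - e + b) * (nu_total t - Q) by apply: mulr_ge0; lra.
move: S1; rewrite /Q; lra.
Qed.


(** * Comparison of two loads *)

Lemma idle_decr_load s t : 0 <= s -> s <= t -> idle s <= idle t.
Proof.
move=> s0 st; have t0 := le_trans s0 st.
by rewrite lef_pV2 ?posrE ?nu_total_gt0// nu_total_decr.
Qed.

(** Monotone likelihood ratio: going to state [n] multiplies [nu t / nu s] by
    [(s + n beta) / (t + n beta) <= 1]. *)
Lemma nu_cross s t n N : 0 <= s -> s <= t -> (n <= N)%N ->
  nu t N * nu s n <= nu s N * nu t n.
Proof.
move=> s0 st /subnK <-; have t0 := le_trans s0 st.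
elim: (N - n)%N => [|k IH]; first by rewrite mulrC.
rewrite addSn !nuS mulrAC [leRHS]mulrAC.
apply: ler_pM => //; last exact: rate_le.
  by rewrite mulr_ge0 ?nu_ge0.
exact/ltW/rate_gt0.
Qed.

Lemma series_cross s t n N : 0 <= s -> s <= t -> (n <= N)%N ->
  series (nu s) n * series (nu t) N <= series (nu t) n * series (nu s) N.
Proof.
move=> s0 st nN; have t0 := le_trans s0 st.
rewrite -(subnK nN); elim: (N - n)%N => [|k IH]; first by rewrite mulrC.
rewrite addSn !seriesnuS !mulrDr lerD// /series /= !mulr_suml.
rewrite ler_sum_nat// => i /andP[_ ik]; rewrite mulrC [leRHS]mulrC.
by apply: nu_cross => //; rewrite ltnW// (leq_trans ik)// leq_addl.
Qed.

(** Likelihood ratio order implies stochastic order: the normalised mass of the first [n] states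
    grows with the load. Since [nu_total t] is a limit, the bound is checked on its partial sums,
    both below and above [n]. *)
Lemma head_cross s t n : 0 <= s -> s <= t ->
  series (nu s) n * nu_total t <= series (nu t) n * nu_total s.
Proof.
move=> s0 st; have t0 := le_trans s0 st.
have [->|n0] := posnP n; first by rewrite !seriesnu0 !mul0r.
have Sn0 : 0 < series (nu s) n.
  by rewrite -(prednK n0) seriesnuS ltr_wpDl ?nu_gt0 ?series_nu_ge0.
have Tn0 := series_nu_ge0 n t0.
rewrite -ler_pdivlMl//; apply: nu_total_le => // N; rewrite ler_pdivlMl//.
have [nN|Nn] := leqP n N.
  apply: le_trans (series_cross s0 st nN) _.
  by rewrite ler_wpM2l// series_nu_le.
rewrite mulrC ler_pM ?series_nu_le ?series_nu_ge0//.
by apply: nondecreasing_series (ltnW Nn) => i _ _; exact: nu_ge0.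
Qed.

(** Each of the [n] factors changes by a relative amount of at most [(t - s) / beta]. *)
Lemma nu_diff s t n : 0 <= s -> s <= t ->
  nu s n - nu t n <= (t - s) / beta * (n%:R * nu s n).
Proof.
move=> s0 st; have t0 := le_trans s0 st.
elim: n => [|n IH]; first by rewrite !nu0 subrr mul0r mulr0.
have qs0 := rate_gt0 n s0; rewrite !nuS.
have qE : e / (s + n.+1%:R * beta) - e / (t + n.+1%:R * beta)
    = e / (s + n.+1%:R * beta) * ((t - s) / (t + n.+1%:R * beta)).
  have := nu_rate_gt0 n s0; have := nu_rate_gt0 n t0.
  by set m := _ * beta => tm sm; field; rewrite !gt_eqF.
have qD : (t - s) / (t + n.+1%:R * beta) <= (t - s) / beta.
  rewrite ler_wpM2l ?subr_ge0// lef_pV2 ?posrE ?nu_rate_gt0//.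
  rewrite -natr1 mulrDl mul1r addrA lerDr addr_ge0// mulr_ge0// ltW//.
have q0 : 0 <= (t - s) / (t + n.+1%:R * beta).
  by rewrite divr_ge0 ?subr_ge0// ltW// nu_rate_gt0.
move: qE qD q0 qs0; set p := e / (s + _); set q := e / (t + _).
set c := (t - s) / (t + _) => qE qD q0 p0.
have -> : nu s n * p - nu t n * q = (nu s n - nu t n) * p + nu t n * (p - q).
  by ring.
have -> : (t - s) / beta * (n.+1%:R * (nu s n * p)) =
    (t - s) / beta * (n%:R * nu s n) * p + (t - s) / beta * (nu s n * p).
  by rewrite -natr1; ring.
rewrite qE; apply: lerD; first by rewrite ler_pM2r.
rewrite mulrA mulrC; apply: ler_pM => //.
  by rewrite mulr_ge0 ?nu_ge0// ltW.
by rewrite ler_pM2r// nu_le.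
Qed.

(** The weight [n] of [nu_diff] is absorbed by [n beta nu s n <= e nu s (n - 1)]. The constant
    explodes as [beta] tends to 0, which is harmless: it only serves to characterise the split of
    one fixed game. *)
Lemma nu_total_lipschitz s t : 0 <= s -> s <= t ->
  nu_total s - nu_total t <= e / beta / beta * nu_total 0 * (t - s).
Proof.
move=> s0 st; have t0 := le_trans s0 st.
have st0 : 0 <= (t - s) / beta by rewrite divr_ge0 ?subr_ge0// ltW.
have H n : nu s n.+1 - nu t n.+1 <= e / beta / beta * (t - s) * nu s n.
  apply: le_trans (nu_diff n.+1 s0 st) _.
  have -> : e / beta / beta * (t - s) * nu s n
          = (t - s) / beta * (e * nu s n / beta) by ring.
  rewrite ler_wpM2l// ler_pdivlMr// mulrAC -nuSM// [leRHS]mulrC.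
  by rewrite ler_wpM2r ?nu_ge0// lerDr.
have S n : series (nu s) n.+1 - series (nu t) n.+1
    <= e / beta / beta * (t - s) * series (nu s) n.
  elim: n => [|n IH]; first by rewrite !seriesnuS !seriesnu0 !nu0 subrr mulr0.
  rewrite seriesnuS (seriesnuS t n.+1) (seriesnuS s n) mulrDr opprD addrACA.
  by rewrite -seriesnuS lerD.
rewrite lerBlDr; apply: nu_total_le => // n.
apply: (@le_trans _ _ (series (nu s) n.+1)).
  by rewrite seriesnuS lerDl nu_ge0.
rewrite -lerBlDr; apply: le_trans (_ : _ <= series (nu s) n.+1 - series (nu t) n.+1) _.
  by rewrite lerD2l lerN2 series_nu_le.
apply: le_trans (S n) _; rewrite mulrAC ler_wpM2r ?subr_ge0//.
rewrite ler_wpM2l ?divr_ge0 ?(ltW e_gt0) ?(ltW beta_gt0)//.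
exact: le_trans (series_nu_le n s0) (nu_total_decr (lexx 0) s0).
Qed.

Section Score.
Variables (alpha : R) (N : nat).
Hypotheses (alpha_gt0 : 0 < alpha) (alpha_lt1 : alpha < 1) (N_gt0 : (0 < N)%N).

Let G := score alpha N.

Lemma score_num_sum_le t : 0 <= t ->
  alpha * \sum_(1 <= n < N.+1) nu t n / n%:R
    <= \sum_(1 <= n < N.+1) nu t n.
Proof.
move=> t0; rewrite mulr_sumr ler_sum_nat// => i /andP[i0 _].
rewrite mulrCA ler_piMr ?nu_ge0// ler_pdivrMr ?ltr0n// mul1r.
by rewrite (le_trans (ltW alpha_lt1))// ler1n.
Qed.

Lemma score_num_head_le t : 0 <= t -> score_num alpha N t <= series (nu t) N.+1.
Proof.
move=> t0; rewrite /series /= big_nat_recl//= nu0 /score_num lerD2l.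
by rewrite -(big_add1 _ _ 0 N.+1 xpredT) score_num_sum_le.
Qed.

Lemma score_num_ge1 t : 0 <= t -> 1 <= score_num alpha N t.
Proof.
move=> t0; rewrite lerDl mulr_ge0 ?(ltW alpha_gt0)// sumr_ge0// => i _.
by rewrite divr_ge0 ?nu_ge0.
Qed.

Lemma score_le1 t : 0 <= t -> G t <= 1.
Proof.
move=> t0; rewrite ler_pdivrMr ?nu_total_gt0// mul1r.
exact: le_trans (score_num_head_le t0) (series_nu_le _ t0).
Qed.

Lemma idle_le_score t : 0 <= t -> idle t <= G t.
Proof.
by move=> t0; rewrite -[leLHS]mul1r ler_wpM2r ?score_num_ge1// ltW// idle_gt0.
Qed.

Lemma score_le_idle t : 0 <= t -> G t <= idle t + alpha.
Proof.
move=> t0; have Z0 := nu_total_gt0 t0.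
rewrite ler_pdivrMr// mulrDl mulVf ?gt_eqF// lerD2l ler_pM2l//.
apply: le_trans (series_nu_le N.+1 t0).
rewrite /series /= [leRHS]big_nat_recl//= nu0 -(big_add1 _ _ 0 N.+1 xpredT).
apply: (@le_trans _ _ (\sum_(1 <= n < N.+1) nu t n)); last by rewrite lerDr.
rewrite ler_sum_nat// => i /andP[i0 _].
by rewrite ler_piMr ?nu_ge0// invf_le1 ?ltr0n// ler1n.
Qed.

(* Abel summation turns the nonincreasing weights [1, alpha, alpha / 2, ...]
   into nonnegative combinations of head sums, for which the comparison is
   [head_cross]; [alpha < 1] makes the weight of state 0 positive. *)
Lemma score_num_cross s t : 0 <= s -> s < t ->
  score_num alpha N s * nu_total t < score_num alpha N t * nu_total s.
Proof.
move=> s0 st; have t0 : 0 <= t := le_trans s0 (ltW st).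
pose C n u := series (nu u) n.+1.
have ZZ := nu_total_strict_decr s0 st.
(* [X n] lowers the weights of the states [0..n] by the last one, [alpha / n], so that state [n]
   drops out. Thus [X 1 = 1 - alpha], and raising [n] adds a nonnegative multiple of a head sum. *)
pose X n u := score_num alpha n u - alpha / n%:R * C n u.
suff H n : (0 < n)%N -> X n s * nu_total t < X n t * nu_total s.
  have := H N N_gt0; have := head_cross N.+1 s0 (ltW st).
  rewrite /X -/(C N _) -/(C N t).
  have : 0 < alpha / N%:R by rewrite divr_gt0// ltr0n.
  set a := alpha / _ => a0 h1 h2.
  have : a * (C N s * nu_total t) <= a * (C N t * nu_total s) by rewrite ler_pM2l.
  lra.
case: n => // n _; elim: n => [|n IH].
  rewrite /X /score_num /C !seriesnuS !seriesnu0 !nu0 !big_nat1 !divr1 add0r.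
  have : 0 < (1 - alpha) * (nu_total s - nu_total t) by rewrite mulr_gt0 ?subr_gt0.
  lra.
have XS u : X n.+2 u = X n.+1 u + alpha * (n.+1%:R^-1 - n.+2%:R^-1) * C n.+1 u.
  rewrite /X /score_num /C big_nat_recr//= (seriesnuS u n.+2).
  ring.
rewrite !XS; have := head_cross n.+2 s0 (ltW st); rewrite -/(C n.+1 s) -/(C n.+1 t).
have : 0 <= alpha * (n.+1%:R^-1 - n.+2%:R^-1).
  rewrite mulr_ge0// ?ltW// subr_gt0 ltf_pV2 ?posrE ?ltr0n// ltr_nat//.
set a := alpha * _ => a0 h1.
have : a * (C n.+1 s * nu_total t) <= a * (C n.+1 t * nu_total s) by rewrite ler_wpM2l.
lra.
Qed.

Lemma score_incr s t : 0 <= s -> s < t -> G s < G t.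
Proof.
move=> s0 st; have t0 : 0 <= t := le_trans s0 (ltW st).
rewrite /G /score ltr_pdivrMr ?nu_total_gt0// mulrAC ltr_pdivlMr ?nu_total_gt0//.
exact: score_num_cross.
Qed.

Lemma score_num_decr s t : 0 <= s -> s <= t -> score_num alpha N t <= score_num alpha N s.
Proof.
move=> s0 st; rewrite lerD2l ler_pM2l// ler_sum// => i _.
by rewrite ler_wpM2r ?invr_ge0// nu_le.
Qed.

(** The numerator decreases in the load, so only the growth of [1 / nu_total] counts; [score <= 1]
    and [nu_total >= 1] reduce it to the variation of [nu_total]. *)
Lemma score_lipschitz s t : 0 <= s -> s <= t ->
  G t - G s <= e / beta / beta * nu_total 0 * (t - s).
Proof.
move=> s0 st; have t0 := le_trans s0 st.
apply: le_trans (nu_total_lipschitz s0 st).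
have Zs := nu_total_gt0 s0; have Zt := nu_total_gt0 t0.
rewrite /G /score; apply: (@le_trans _ _
  (score_num alpha N s / nu_total t - score_num alpha N s / nu_total s)).
  by rewrite lerD2r ler_wpM2r ?score_num_decr// invr_ge0 ltW.
have -> : score_num alpha N s / nu_total t - score_num alpha N s / nu_total s
    = score_num alpha N s / nu_total s * ((nu_total s - nu_total t) / nu_total t).
  by field; rewrite !gt_eqF.
have ZZ : 0 <= (nu_total s - nu_total t) / nu_total t.
  by rewrite divr_ge0 ?subr_ge0 ?nu_total_decr// ltW.
apply: (@le_trans _ _ (1 * ((nu_total s - nu_total t) / nu_total t))).
  by rewrite ler_wpM2r//; exact: score_le1.
rewrite mul1r ler_pdivrMr// ler_peMr ?nu_total_ge1// subr_ge0.
exact: nu_total_decr.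
Qed.

End Score.
End Queue.

(** The error [beta K + e / (K + 1)] of [idle_overload] is split into two halves [delta e / 2]:
    [K > 2 / delta] handles the second, then [betabar] the first. Underload follows by monotonicity
    from [t = e]. *)
Lemma idle_fluid (R : realType) (e delta : R) : 0 < e -> 0 < delta ->
  exists2 betabar, 0 < betabar & forall beta, 0 < beta <= betabar ->
    (forall t, 0 <= t <= e -> idle e beta t <= delta) /\
    (forall t, e <= t -> t * idle e beta t <= t - e + delta * e).
Proof.
move=> e0 d0; pose K := (Num.truncn (2 / delta)).+1.
have K0 : 0 < K%:R :> R by rewrite ltr0n.
have KP : 2 / delta < K%:R by rewrite truncnS_gt.
move: K K0 KP => K K0 KP.
exists (delta * e / 2 / K%:R); first by rewrite !divr_gt0// mulr_gt0.
move=> beta /andP[b0 bb].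
have H t : e <= t -> t * idle e beta t <= t - e + delta * e.
  move=> et; apply: le_trans (idle_overload e0 b0 K et) _; rewrite lerD2l.
  have : beta * K%:R <= delta * e / 2 by rewrite -ler_pdivlMr.
  have : e / K.+1%:R <= delta * e / 2.
    rewrite ler_pdivrMr ?ltr0n//.
    have : 2 < delta * K.+1%:R.
      rewrite -ltr_pdivrMl// mulrC (lt_le_trans KP)// ler_nat//.
    set k := K.+1%:R => k2; have : 0 < (delta * k - 2) * e by rewrite mulr_gt0// subr_gt0.
    lra.
  move: (e / _) (beta * _) => a b; lra.
split => // t /andP[t0 te]; apply: le_trans (idle_decr_load e0 b0 t0 te) _.
have := H e (lexx e); rewrite subrr add0r mulrC.
by rewrite ler_pM2r.
Qed.

Lemma derive_inP (R : realType) (A : set R) (f : R -> R) (x eps : R) :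
  derivable_in A f x -> 0 < eps -> exists2 delta, 0 < delta &
    forall y, A y -> y != x -> `|y - x| < delta ->
      `|diff_quotient f x y - derive_in A f x| < eps.
Proof.
move=> /cvgrPdist_lt/[apply]; rewrite !nearE /within /= => /nbhs_normP[d /= d0 H].
exists d => // y Ay yx yd; rewrite distrC; apply: H => //.
by rewrite /ball_ /= distrC.
Qed.

Lemma within_continuous_dist (R : realType) (a b : R) (f : R -> R) :
  (forall x eps, a <= x <= b -> 0 < eps -> exists2 delta, 0 < delta &
    forall y, a <= y <= b -> `|y - x| < delta -> `|f y - f x| < eps) ->
  {within `[a, b], continuous f}.
Proof.
move=> H; apply/subspace_continuousP => x; rewrite /= in_itv /= => xab.
apply/cvgrPdist_lt => eps eps0; have [d d0 Hd] := H _ _ xab eps0.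
rewrite nearE /within /=; apply/nbhs_normP; exists d => //= y.
rewrite /ball_ /= in_itv /= => xy yab.
by rewrite distrC; apply: Hd => //; rewrite distrC.
Qed.

Lemma max_ofP (R : realType) (A : set R) :
  (exists m, A m /\ ubound A m) -> A (max_of A) /\ ubound A (max_of A).
Proof. exact: (@xgetPex _ 0 [set m | A m /\ ubound A m]). Qed.

(** * The demand function and the Edgeworth interval *)

Section Demand.
Variables (R : realType) (phih : R) (f : R -> R).
Hypotheses (phih_gt0 : 0 < phih)
  (f_concave : forall a b c, 0 <= a -> a <= b -> b <= c -> c <= phih ->
     (c - b) * f a + (b - a) * f c <= (c - a) * f b)
  (f_decr : forall x y, 0 <= x -> x < y -> y <= phih -> f y < f x)
  (f_gt0 : forall x, 0 <= x -> x <= phih -> 0 < f x)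
  (f0 : f 0 = 1).

Lemma f_noninc x y : 0 <= x -> x <= y -> y <= phih -> f y <= f x.
Proof.
move=> x0; rewrite le_eqVlt => /orP[/eqP->//|xy] yh.
exact/ltW/f_decr.
Qed.

Lemma f_le1 x : 0 <= x -> x <= phih -> f x <= 1.
Proof. by move=> x0 xh; rewrite -f0 f_noninc. Qed.

(* The decrements of a concave function grow, so the smallest one over a given
   distance is the one starting at 0. *)
Lemma f_gap x y d : 0 <= y -> 0 <= d -> y + d <= x -> x <= phih ->
  1 - f d <= f y - f x.
Proof.
move=> y0 d0 ydx xh.
have ydh : y + d <= phih by lra.
have fx : f x <= f (y + d) by rewrite f_noninc// addr_ge0.
suff : 1 + f (y + d) <= f y + f d by lra.
have [yd0|yd0] := leP (y + d) 0.
  have -> : d = 0 by lra.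
  by rewrite addr0 addrC f0.
rewrite -(ler_pM2l yd0) mulrDr mulr1 mulrDr.
have := @f_concave 0 y (y + d) (lexx 0) y0 _ ydh.
have := @f_concave 0 d (y + d) (lexx 0) d0 _ ydh.
rewrite f0 !subr0 lerDl lerDr => /(_ y0) h1 /(_ d0); lra.
Qed.

Lemma f_gap_gt0 d : 0 < d -> d <= phih -> 0 < 1 - f d.
Proof. by move=> d0 dh; rewrite subr_gt0 -f0 f_decr. Qed.

(* [x f(x)] inherits concavity from the decreasing concave [f]. *)
Lemma revenue_concave c x y z : 0 <= x -> x <= y -> y <= z -> z <= phih ->
  (z - y) * ((f x - c) * x) + (y - x) * ((f z - c) * z)
    <= (z - x) * ((f y - c) * y).
Proof.
move=> x0 xy yz zh; have := f_concave x0 xy yz zh.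
have : f z <= f x by apply: f_noninc => //; exact: le_trans yz.
move: (f x) (f y) (f z) => u v w wu h.
have y0 : 0 <= y by exact: le_trans xy.
have h1 : 0 <= y * ((z - x) * v - ((z - y) * u + (y - x) * w)).
  by rewrite mulr_ge0// subr_ge0.
have h2 : 0 <= (z - y) * (y - x) * (u - w).
  by rewrite !mulr_ge0 ?subr_ge0.
nra.
Qed.

(** * Tangent lines and the threshold price [phi_b] *)

Section Derivative.
Hypothesis f_derivable : forall x, 0 <= x -> x <= phih ->
  derivable_in `[0, phih] f x.

Let g := derive_in `[0, phih] f.

Lemma f_cont x eps : 0 <= x <= phih -> 0 < eps -> exists2 delta, 0 < delta &
  forall y, 0 <= y <= phih -> `|y - x| < delta -> `|f y - f x| < eps.
Proof.
move=> /andP[x0 xh] eps0.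
have [d d0 H] := derive_inP (f_derivable x0 xh) (@ltr01 R).
have c0 : 0 < `|g x| + 1 by rewrite ltr_wpDl.
exists (Num.min d (eps / (`|g x| + 1))).
  by rewrite lt_min d0 divr_gt0.
move=> y yh; rewrite lt_min ltr_pdivlMr// => /andP[yd yeps].
have [->|yx] := eqVneq y x; first by rewrite subrr normr0.
apply: le_lt_trans yeps; have := H y; rewrite /= in_itv /= => /(_ yh yx yd) h.
have yx0 : y - x != 0 by rewrite subr_eq0.
have -> : f y - f x = (y - x) * diff_quotient f x y.
  by rewrite /diff_quotient mulrC divfK.
rewrite normrM ler_wpM2l//.
have := ler_normD (diff_quotient f x y - g x) (g x); rewrite subrK.
rewrite -/(g x) in h; lra.
Qed.

Lemma f_within : {within `[0, phih], continuous f}.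
Proof. by apply: within_continuous_dist => x eps xh e0; exact: f_cont. Qed.

(** Were [f y] above the tangent, concavity would keep the slopes of the secants from [x] to points
    [z] towards [y] at least [eps] away from [g x], however close [z] is to [x]. Such [z] stay in
    [[0, phih]], so the one-sided derivatives at the endpoints are covered. *)
Lemma supergradient x y : 0 <= x -> x <= phih -> 0 <= y -> y <= phih ->
  f y <= f x + g x * (y - x).
Proof.
move=> x0 xh y0 yh; have [->|yx] := eqVneq y x; first by rewrite subrr mulr0 addr0.
have yxn0 : `|y - x| > 0 by rewrite normr_gt0 subr_eq0.
rewrite leNgt; apply/negP => lt_f.
pose eps := (f y - f x - g x * (y - x)) / `|y - x|.
have eps0 : 0 < eps by rewrite divr_gt0//; lra.
have [d d0 H] := derive_inP (f_derivable x0 xh) eps0.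
pose s := Num.min (1 / 2) (d / (2 * `|y - x|)).
have s0 : 0 < s by rewrite lt_min !divr_gt0// mulr_gt0.
have s1 : s < 1 by rewrite gt_min; apply/orP; left; lra.
have sd : s * `|y - x| < d.
  have : s <= d / (2 * `|y - x|) by rewrite ge_min lexx orbT.
  rewrite ler_pdivlMr ?mulr_gt0//; lra.
pose z := x + s * (y - x).
have zx : z != x by rewrite -subr_eq0 /z addrC addKr mulf_neq0 ?subr_eq0// gt_eqF.
have zE : z - x = s * (y - x) by rewrite /z; ring.
have zd : `|z - x| < d by rewrite zE normrM gtr0_norm.
have := H z; rewrite /= in_itv /= -/(g x).
have [xy|yx'] := ltP x y.
  have zh : 0 <= z <= phih by rewrite /z; nra.
  move=> /(_ zh zx zd); rewrite /diff_quotient /eps.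
  rewrite (gtr0_norm (_ : 0 < y - x)) ?subr_gt0//.
  rewrite zE => /ltr_normlP[_ h2].
  have := @f_concave x z y x0 _ _ yh; rewrite -/z.
  move=> /(_ ltac:(rewrite /z; nra) ltac:(rewrite /z; nra)) h1.
  have xy0 : 0 < y - x by rewrite subr_gt0.
  have h3 : (f z - f x) / (s * (y - x)) < (f y - f x) / (y - x).
    have E : (f y - f x - g x * (y - x)) / (y - x) = (f y - f x) / (y - x) - g x.
      by field; rewrite gt_eqF.
    rewrite E in h2; lra.
  move: h3; rewrite ltr_pdivrMr ?mulr_gt0// mulrCA divfK ?gt_eqF//.
  move: h1; rewrite zE (_ : y - z = (1 - s) * (y - x)); last by rewrite /z; ring.
  move: (f z) => fz h1 h3; nra.
have {}yx' : y < x by rewrite lt_neqAle yx.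
have yx0 : y - x < 0 by rewrite subr_lt0.
have zh : 0 <= z <= phih by rewrite /z; nra.
move=> /(_ zh zx zd); rewrite /diff_quotient /eps (ltr0_norm yx0).
rewrite zE => /ltr_normlP[h2 _].
have := @f_concave y z x y0 _ _ xh; rewrite -/z.
move=> /(_ ltac:(rewrite /z; nra) ltac:(rewrite /z; nra)) h1.
have h3 : (f y - f x) / (y - x) < (f z - f x) / (s * (y - x)).
  have E : (f y - f x - g x * (y - x)) / - (y - x) = - ((f y - f x) / (y - x)) + g x.
    by field; rewrite subr_eq0.
  rewrite E in h2; lra.
move: h3; rewrite ltr_ndivlMr ?nmulr_llt0// ?pmulr_rlt0// mulrCA divfK ?lt_eqF//.
move: h1; rewrite (_ : x - z = s * (x - y)); last by rewrite /z; ring.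
rewrite (_ : z - y = (1 - s) * (x - y)); last by rewrite /z; ring.
move: (f z) => fz h1 h3; nra.
Qed.

Let b := phi_b phih f.
Let A := [set x | `[0, phih]%classic x /\ 0 <= f x + 2 * x * g x].

(** Closedness of [A] is obtained without continuity of [g]. For [z] in [A] the supergradient
    inequality becomes [2 z f y <= f z (3 z - y)] for [y < z], which involves values of [f] only and
    so passes to the supremum [s]. It bounds the left difference quotients at [s] below by
    [- f s / (2 s)], hence also [g s]. *)
Lemma phi_b_set_max : A (max_of A) /\ ubound A (max_of A).
Proof.
have A0 : A 0 by split; rewrite /= ?in_itv /= ?lexx ?ltW// f0 mulr0 mul0r addr0.
have Ah x : A x -> 0 <= x <= phih by case; rewrite /= in_itv.
have supA : has_sup A.
  by split; [exists 0 | exists phih => x /Ah/andP[]].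
apply: max_ofP; exists (sup A).
have ub : ubound A (sup A) by exact: sup_upper_bound.
split=> //; pose s := sup A; rewrite -/s.
have s0 : 0 <= s by exact: ub.
have sh : s <= phih by apply: ge_sup; [exists 0 | move=> x /Ah/andP[]].
split; first by rewrite /= in_itv /= s0.
have [->|sn0] := eqVneq s 0; first by rewrite f0 mulr0 mul0r addr0.
have {}s0 : 0 < s by rewrite lt_neqAle eq_sym sn0.
have slope y : 0 <= y -> y < s -> 2 * s * f y <= f s * (3 * s - y).
  move=> y0 ys; rewrite leNgt; apply/negP => lt_f.
  pose eta := 2 * s * f y - f s * (3 * s - y).
  have eta0 : 0 < eta by rewrite subr_gt0.
  (* Half of [eta] pays for replacing [f z] by [f s], with a factor of at most [3 s]; the other half
     pays for replacing [z] by [s], through [d' <= eta / 4]. *)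
  have seps : 0 < eta / (6 * s) by rewrite divr_gt0// mulr_gt0.
  have sin : 0 <= s <= phih by rewrite (ltW s0).
  have [d d0 H] := f_cont sin seps.
  pose d' := Num.min (s - y) (Num.min d (eta / 4)).
  have d'0 : 0 < d' by rewrite !lt_min subr_gt0 ys d0 divr_gt0.
  have [z Az zs] := sup_adherent d'0 supA; rewrite -/s in zs.
  have /andP[z0 zh] := Ah _ Az; have zles : z <= s := ub _ Az.
  have dy : d' <= s - y by rewrite ge_min lexx.
  have dd : d' <= d by rewrite !ge_min lexx orbT.
  have de : d' <= eta / 4 by rewrite !ge_min lexx !orbT.
  have /ltr_normlP[_ fz] : `|f z - f s| < eta / (6 * s).
    by apply: H; rewrite ?z0//; apply/ltr_normlP; split; lra.
  have yh : y <= phih by lra.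
  have := supergradient z0 zh y0 yh => sg.
  have gz : 0 <= f z + 2 * z * g z by case: Az.
  have h : 2 * z * f y <= f z * (3 * z - y) by nra.
  have fy1 : f y <= 1 by apply: f_le1 => //; lra.
  have fz0 : 0 < f z by exact: f_gt0.
  have h2 : f z * (3 * z - y) <= f z * (3 * s - y) by rewrite ler_pM2l//; lra.
  have h3 : (f z - f s) * (3 * s - y) <= eta / 2.
    apply: (@le_trans _ _ (eta / (6 * s) * (3 * s - y))).
      by rewrite ler_wpM2r//; lra.
    apply: (@le_trans _ _ (eta / (6 * s) * (3 * s))).
      by rewrite ler_pM2l//; lra.
    suff -> : eta / (6 * s) * (3 * s) = eta / 2 by [].
    by field; rewrite gt_eqF.
  have h4 : 2 * s * f y - 2 * z * f y < eta / 2.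
    have : (s - z) * f y <= s - z by rewrite ler_piMr//; lra.
    lra.
  move: h h2 h3 h4; rewrite /eta; lra.
rewrite leNgt; apply/negP => lt0.
have gs : g s < - (f s / (2 * s)).
  rewrite -mulNr ltr_pdivlMr ?mulr_gt0//; lra.
rewrite -subr_gt0 in gs.
have [d d0 H] := derive_inP (f_derivable (ltW s0) sh) gs.
pose h := Num.min s d / 2.
have hs : h <= s / 2 by rewrite ler_pM2r// ge_min lexx.
have hd : h <= d / 2 by rewrite ler_pM2r// ge_min lexx orbT.
have h0 : 0 < h by rewrite divr_gt0// lt_min s0.
have := H (s - h); rewrite /= in_itv /= lt_eqF; last by lra.
have -> : s - h - s = - h by ring.
rewrite normrN gtr0_norm//.
have -> : (0 <= s - h <= phih) by apply/andP; split; lra.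
have hd' : h < d by lra.
move=> /(_ isT isT hd') /ltr_normlP[_].
rewrite /diff_quotient -/g; have -> : s - h - s = - h by ring.
have := slope (s - h); move=> /(_ ltac:(lra) ltac:(lra)) h1 h2.
have : (f (s - h) - f s) / (- h) < - (f s / (2 * s)) by lra.
have -> : (f (s - h) - f s) / (- h) = - ((f (s - h) - f s) / h).
  by field; rewrite gt_eqF.
rewrite ltrN2 ltr_pdivlMr// mulrC mulrA ltr_pdivrMr ?mulr_gt0//.
move: h1; lra.
Qed.

Lemma phi_b_in : 0 <= b <= phih.
Proof. by have [[]] := phi_b_set_max; rewrite /= in_itv. Qed.

Lemma phi_b_ge0 : 0 <= f b + 2 * b * g b.
Proof. by have [[]] := phi_b_set_max. Qed.

Lemma phi_b_lt0 x : b < x -> x <= phih -> f x + 2 * x * g x < 0.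
Proof.
move=> bx xh; rewrite ltNge; apply/negP => x0.
have /andP[b0 _] := phi_b_in.
have Ax : A x by split=> //; rewrite /= in_itv /= xh (le_trans b0)// ltW.
by have [_ /(_ x Ax)] := phi_b_set_max; rewrite leNgt bx.
Qed.

(** For [z] beyond [phi_b] this is the tangent at [z] with [g z < - f z / (2 z)]. At [z = phi_b] the
    sign condition is the opposite one, so the bound is reached from [b + h] with small [h], by
    continuity of [f]. *)
Lemma after_phi_b z x : b <= z -> z < x -> x <= phih ->
  2 * z * f x <= f z * (3 * z - x).
Proof.
have /andP[b0 bh] := phi_b_in.
have strict y : b < y -> y < x -> x <= phih -> 2 * y * f x <= f y * (3 * y - x).
  move=> yb yx xh; have yh : y <= phih by lra.
  have y0 : 0 <= y by lra.
  have x0 : 0 <= x by lra.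
  have := supergradient y0 yh x0 xh => sg.
  have gy := phi_b_lt0 yb yh; nra.
rewrite le_eqVlt => /orP[/eqP <-{z}|]; last exact: strict.
move=> bx xh; rewrite leNgt; apply/negP => lt_f.
pose eta := 2 * b * f x - f b * (3 * b - x).
have eta0 : 0 < eta by rewrite subr_gt0.
have seps : 0 < eta / (6 * phih) by rewrite divr_gt0// mulr_gt0.
have [d d0 H] := f_cont phi_b_in seps.
pose h := Num.min (x - b) (Num.min d (eta / 3)) / 2.
have hx : h <= (x - b) / 2 by rewrite ler_pM2r// ge_min lexx.
have hd : h <= d / 2 by rewrite ler_pM2r// !ge_min lexx !orbT.
have he : h <= eta / 3 / 2 by rewrite ler_pM2r// !ge_min lexx !orbT.
have h0 : 0 < h by rewrite divr_gt0// !lt_min subr_gt0 bx d0 divr_gt0.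
have := strict (b + h); move=> /(_ ltac:(lra) ltac:(lra) xh).
have /ltr_normlP[fz _] : `|f (b + h) - f b| < eta / (6 * phih).
  apply: H; first by apply/andP; split; lra.
  by rewrite addrC addKr gtr0_norm//; lra.
have fb : f (b + h) <= f b by apply: f_noninc; lra.
have f1 : f (b + h) <= 1 by apply: f_le1; lra.
have fx : 0 < f x by apply: f_gt0; lra.
have fbh : 0 < f (b + h) by apply: f_gt0; lra.
move: (f (b + h)) fz fb f1 fbh => v fz fb f1 v0 h1.
have h2 : (f b - v) * (x - 3 * b) <= eta / 2.
  apply: (@le_trans _ _ ((f b - v) * (3 * phih))).
    by rewrite ler_wpM2l//; lra.
  apply: (@le_trans _ _ (eta / (6 * phih) * (3 * phih))).
    by rewrite ler_wpM2r//; lra.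
  suff -> : eta / (6 * phih) * (3 * phih) = eta / 2 by [].
  by field; rewrite gt_eqF.
have h3 : v * h <= h by rewrite ler_piMl// ltW.
have h4 : 0 < h * f x by rewrite mulr_gt0.
move: h1 h2; rewrite /eta in he eta0 *; lra.
Qed.

(** * The residual revenue and its maximiser *)

Section Residual.
Variables (Lam e : R).
Hypotheses (Lam_gt0 : 0 < Lam) (e_gt0 : 0 < e).
Let rho := e / Lam.
Hypothesis rho_lt1 : rho < 1.
Let r := residual f Lam e.

Let rho_gt0 : 0 < rho.
Proof. exact: divr_gt0. Qed.

(** Here [r z = z], and [after_phi_b] multiplied by [x] gives [z x (f x - rho) <= rho x (2 z - x) =
    rho (z^2 - (x - z)^2)]. *)
Lemma residual_after_phi_b z x : b <= z -> z < x -> x <= phih ->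
  f z = 2 * rho -> r x <= z.
Proof.
move=> bz zx xh fz; have /andP[b0 _] := phi_b_in.
have := after_phi_b bz zx xh; rewrite fz => h.
have z0 : 0 < z.
  rewrite lt_neqAle (le_trans b0 bz) andbT; apply/eqP => z0.
  move: h; rewrite -z0 in zx *; rewrite !mulr0 mul0r.
  have : 0 < rho * x by rewrite mulr_gt0.
  lra.
rewrite ler_pdivrMr// -(ler_pM2l z0).
have : 0 <= rho * (x - z) ^+ 2 by rewrite mulr_ge0 ?sqr_ge0// ltW.
have : 0 <= x * (2 * rho * (3 * z - x) - 2 * z * f x).
  apply: mulr_ge0; last by rewrite subr_ge0.
  exact: ltW (lt_trans z0 zx).
rewrite -/rho; nra.
Qed.

(** The mirror image, with the tangent at [phi_b]: there [r] exceeds [z = r z], so the maximum of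
    [r] is larger than the price at which [f = 2 rho]. *)
Lemma residual_before_phi_b z : 0 <= z -> z < b -> f z = 2 * rho ->
  f b < 2 * rho -> z < r b.
Proof.
move=> z0 zb fz fb; have /andP[b0 bh] := phi_b_in.
have := supergradient b0 bh z0 (ltac:(lra)); rewrite fz => h.
have gb := phi_b_ge0.
rewrite ltr_pdivlMr// -/rho.
have := ltr_pM2l (_ : 0 < b - z) (f b) (2 * rho).
rewrite fb subr_gt0 => /(_ zb) h1.
have : b * (2 * rho) <= b * (f b + g b * (z - b)) by rewrite ler_wpM2l.
have : 0 <= (b - z) * (f b + 2 * b * g b) by rewrite mulr_ge0// subr_ge0 ltW.
nra.
Qed.

Lemma residual_concave x y z : 0 <= x -> x <= y -> y <= z -> z <= phih ->
  (z - y) * r x + (y - x) * r z <= (z - x) * r y.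
Proof.
move=> x0 xy yz zh; rewrite /r /residual !mulrA -mulrDl ler_pM2r ?invr_gt0//.
by have := revenue_concave rho x0 xy yz zh; rewrite !mulrA.
Qed.

Let L := phi_L phih f Lam e.
Let Rr := phi_R phih f Lam e.

Lemma phi_RP : [/\ 0 <= Rr, Rr <= phih & forall x, 0 <= x -> x <= phih -> r x <= r Rr].
Proof.
have [c ch cmax] : exists2 c, c \in `[0, phih] & forall t, t \in `[0, phih] -> r t <= r c.
  have id_cont : {within `[0, phih], continuous (@idfun R)}.
    by apply: continuous_subspaceT => x; exact: cvg_id.
  apply: EVT_max (ltW phih_gt0) _ => x; apply: cvgMl.
  apply: cvgM; last exact: id_cont.
  by apply: cvgB; [exact: f_within | exact: cvg_cst].
have : exists x, `[0, phih]%classic x /\ forall y, `[0, phih]%classic y -> r y <= r x.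
  by exists c; split=> // y; exact: cmax.
move=> /(@xgetPex _ 0 [set x | `[0, phih]%classic x /\
    forall y, `[0, phih]%classic y -> r y <= r x]) [].
rewrite -/(argmax _ _) -/Rr /= in_itv /= => /andP[? ?] h; split=> // x x0 xh.
by apply: h; rewrite /= in_itv /= x0.
Qed.

Lemma phi_LE : L = r Rr.
Proof.
have [R0 Rh Rmax] := phi_RP.
have Rin : `[0, phih]%classic Rr by rewrite /= in_itv /= R0.
have : (r @` `[0, phih]) (r Rr) /\ ubound (r @` `[0, phih]) (r Rr).
  split; first by exists Rr.
  by move=> _ [x /= + <-]; rewrite in_itv /= => /andP[x0 xh]; exact: Rmax.
move=> H; have [] := max_ofP (ex_intro _ _ H); rewrite -/L => [[x]] /=.
rewrite in_itv /= => /andP[x0 xh] xL ubL.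
apply/eqP; rewrite eq_le; apply/andP; split; last by apply: ubL; exists Rr.
by have -> : L = r x by []; exact: Rmax.
Qed.

Lemma residual_le_L x : 0 <= x -> x <= phih -> r x <= L.
Proof. by move=> x0 xh; rewrite phi_LE; have [_ _] := phi_RP; apply. Qed.

Lemma residual_nondecr x y : 0 <= x -> x <= y -> y <= Rr -> r x <= r y.
Proof.
move=> x0; rewrite le_eqVlt => /orP[/eqP->//|xy] yR.
have [R0 Rh Rmax] := phi_RP.
have := residual_concave x0 (ltW xy) yR Rh.
have := Rmax x x0 (ltac:(lra)).
move: (r x) (r y) (r Rr) => u v w uw h.
rewrite -(ler_pM2l (_ : 0 < Rr - x)); last by lra.
have : (y - x) * u <= (y - x) * w by rewrite ler_wpM2l//; lra.
lra.
Qed.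

Lemma phi_L_gt0 : 0 < L.
Proof.
have eps0 : 0 < 1 - rho by rewrite subr_gt0.
have z0 : 0 <= (0 : R) <= phih by rewrite lexx ltW.
have [d d0 H] := f_cont z0 eps0.
pose x := Num.min d phih / 2.
have x0 : 0 < x by rewrite divr_gt0// lt_min d0.
have xd : x <= d / 2 by rewrite ler_pM2r// ge_min lexx.
have xh : x <= phih / 2 by rewrite ler_pM2r// ge_min lexx orbT.
have xin : 0 <= x <= phih by apply/andP; split; lra.
have xd' : `|x - 0| < d by rewrite subr0 gtr0_norm//; lra.
have /ltr_normlP[fx _] := H x xin xd'; rewrite f0 in fx.
have : 0 < r x by rewrite /r /residual divr_gt0// mulr_gt0// subr_gt0 -/rho; lra.
by move=> /lt_le_trans; apply; apply: residual_le_L; lra.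
Qed.

(** Let [z] solve [f z = 2 rho]. Then [z = r z < r b <= L], and concavity puts the maximiser of [r]
    beyond [z] as well. Finally [f Rr < 2 rho] means [r Rr < Rr], that is [L < Rr]. *)
Lemma edgeworth : f b / 2 < rho ->
  [/\ L < Rr, rho < f Rr, f L < 2 * rho & f Rr < 2 * rho].
Proof.
move=> fb2; have fb : f b < 2 * rho by lra.
have [R0 Rh Rmax] := phi_RP; have L0 := phi_L_gt0.
have rE x : rho * r x = (f x - rho) * x.
  by rewrite /r /residual -/rho mulrC divfK ?gt_eqF.
have Rgt0 : 0 < Rr.
  rewrite lt_neqAle R0 andbT; apply/eqP => h.
  by move: L0; rewrite phi_LE /r /residual -h mulr0 mul0r ltxx.
have fR : rho < f Rr.
  rewrite -subr_gt0 -(pmulr_lgt0 _ Rgt0) -rE -phi_LE.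
  exact: mulr_gt0.
suff [fR2 fL2] : f Rr < 2 * rho /\ (L <= phih -> f L < 2 * rho).
  have LR : L < Rr.
    rewrite -(ltr_pM2l rho_gt0) phi_LE rE ltr_pM2r//; lra.
  by split=> //; apply: fL2; lra.
(* If [2 rho > 1] there is no such [z], and [f <= 1] suffices. *)
have [rho2|rho2] := ltP 1 (2 * rho).
  by split=> [|Lh]; apply: le_lt_trans rho2; apply: f_le1 => //; lra.
have /andP[b0 bh] := phi_b_in.
have [z zb fz] : exists2 z, z \in `[0, b] & f z = 2 * rho.
  apply: IVT => //.
    apply: continuous_subspaceW f_within.
    by apply: subset_itvl; rewrite bnd_simp.
  by rewrite f0 ge_min le_max rho2 (ltW fb) orbT.
move: zb; rewrite in_itv /= => /andP[z0 zb].
have {}zb : z < b.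
  by rewrite lt_neqAle zb andbT; apply/eqP => h; move: fb; rewrite -h fz ltxx.
have zr := residual_before_phi_b z0 zb fz fb.
have rz : r z = z by rewrite /r /residual fz -/rho; field; rewrite gt_eqF.
have bL := residual_le_L b0 bh.
split=> [|Lh]; rewrite -fz; apply: f_decr => //; last by lra.
(* If [Rr <= z < b], concavity would make [r z = z] at least an average of [L] and [r b], where
   [L > z], [r b > z] and [L] has positive weight. *)
rewrite ltNge; apply/negP => Rz.
have := residual_concave R0 Rz (ltW zb) bh; rewrite -phi_LE rz.
have zR : 0 <= z - Rr by lra.
have : (b - z) * z < (b - z) * L by rewrite ltr_pM2l//; lra.
have : (z - Rr) * z <= (z - Rr) * r b by rewrite ler_wpM2l//; lra.
lra.
Qed.

End Residual.
End Derivative.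
End Demand.

Lemma residualM (R : realType) (f : R -> R) (Lam e x : R) : 0 < Lam -> 0 < e ->
  e * residual f Lam e x = x * (Lam * f x - e).
Proof. by move=> Lam0 e0; rewrite /residual; field; rewrite !gt_eqF. Qed.

(** * The distribution function of [sigma*] *)

Section EdgeworthCdf.
Variables (R : realType) (phih : R) (f : R -> R) (Lam e L Rr : R).
Let r := residual f Lam e.
Hypotheses (Lam_gt0 : 0 < Lam) (e_gt0 : 0 < e) (L_gt0 : 0 < L) (LR : L < Rr)
  (Rh : Rr <= phih)
  (f_noninc : forall x y, 0 <= x -> x <= y -> y <= phih -> f y <= f x)
  (fL : Lam * f L < 2 * e) (fR : e < Lam * f Rr) (rR : r Rr = L)
  (r_le : forall x, 0 <= x -> x <= phih -> r x <= L)
  (r_nondecr : forall x y, 0 <= x -> x <= y -> y <= Rr -> r x <= r y).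

Definition edgeworth_cdf x := (x - L) / (x - r x).

Let F := edgeworth_cdf.
Let q x := x - r x.

Let rM x : e * r x = x * (Lam * f x - e).
Proof. exact: residualM. Qed.

Let qM x : e * q x = x * (2 * e - Lam * f x).
Proof. by rewrite /q mulrBr rM; ring. Qed.

Let x_ge0 x : L <= x -> 0 <= x.
Proof. exact/le_trans/ltW. Qed.

Let x_le x : x <= Rr -> x <= phih.
Proof. by move=> xR; exact: le_trans Rh. Qed.

Let f_lt x : L <= x -> x <= Rr -> Lam * f x < 2 * e.
Proof.
move=> Lx xR; apply: le_lt_trans fL; rewrite ler_pM2l// f_noninc//; first exact: ltW.
exact: le_trans Rh.
Qed.

Lemma residual_gt0 x : L <= x -> x <= Rr -> 0 < r x.
Proof.
move=> Lx xR; have x0 := lt_le_trans L_gt0 Lx.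
rewrite -(pmulr_rgt0 _ e_gt0) rM mulr_gt0// subr_gt0 (lt_le_trans fR)//.
by rewrite ler_pM2l// f_noninc// ltW.
Qed.

Let q_gt0 x : L <= x -> x <= Rr -> 0 < q x.
Proof.
move=> Lx xR; have x0 := lt_le_trans L_gt0 Lx.
by rewrite -(pmulr_rgt0 _ e_gt0) qM mulr_gt0// subr_gt0 f_lt.
Qed.

Let q_nondecr x y : L <= x -> x <= y -> y <= Rr -> q x <= q y.
Proof.
move=> Lx xy yR; have x0 := lt_le_trans L_gt0 Lx.
rewrite -(ler_pM2l e_gt0) !qM; apply: ler_pM => //; first exact: ltW.
  by rewrite subr_ge0 ltW// f_lt// (le_trans xy).
by rewrite lerD2l lerN2 ler_pM2l// f_noninc ?x_ge0 ?x_le.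
Qed.

(** Two forms of [F] are used. Monotonicity comes from [1 - F = (L - r) / q], whose numerator
    decreases while [q] increases; the Lipschitz bound comes from [(x - L) / q], where [q] is
    bounded below by [q L]. *)
Lemma edgeworth_cdf_lipschitz x y : L <= x -> x <= y -> y <= Rr ->
  0 <= F y - F x <= (q L)^-1 * (y - x).
Proof.
move=> Lx xy yR; have xR := le_trans xy yR; have Ly := le_trans Lx xy.
have qx := q_gt0 Lx xR; have qy := q_gt0 Ly yR.
have qL := q_gt0 (lexx L) (ltW LR).
have FE z : 0 < q z -> F z = 1 - (L - r z) / q z.
  by move=> qz; rewrite /F /edgeworth_cdf -/(q z) /q; field; rewrite gt_eqF.
apply/andP; split.
  rewrite !FE//; suff : (L - r y) / q y <= (L - r x) / q x by lra.
  apply: ler_pM; rewrite ?invr_ge0 ?(ltW qy)//.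
  - by rewrite subr_ge0 r_le ?x_ge0 ?x_le.
  - by rewrite lerD2l lerN2 r_nondecr ?x_ge0.
  - by rewrite lef_pV2 ?posrE// q_nondecr.
rewrite /F /edgeworth_cdf -/(q x) -/(q y).
apply: (@le_trans _ _ ((y - L) / q x - (x - L) / q x)).
  by rewrite lerD2r ler_wpM2l ?subr_ge0// lef_pV2 ?posrE// q_nondecr.
rewrite -mulrBl (_ : y - L - (x - L) = y - x); last by ring.
by rewrite mulrC ler_wpM2r ?subr_ge0// lef_pV2 ?posrE// q_nondecr.
Qed.

Lemma edgeworth_cdfL : F L = 0.
Proof. by rewrite /F /edgeworth_cdf subrr mul0r. Qed.

Lemma edgeworth_cdfR : F Rr = 1.
Proof. by rewrite /F /edgeworth_cdf rR divff// subr_eq0 gt_eqF. Qed.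

Lemma edgeworth_cdf_itv x : L <= x -> x <= Rr -> 0 <= F x <= 1.
Proof.
move=> Lx xR; have /andP[h1 _] := edgeworth_cdf_lipschitz (lexx L) Lx xR.
have /andP[h2 _] := edgeworth_cdf_lipschitz Lx xR (lexx Rr).
by move: h1 h2; rewrite edgeworth_cdfL edgeworth_cdfR; lra.
Qed.

(* In units of [e], [x] is the limit payoff of undercutting the opponent and
   [r x] that of being undercut. *)
Lemma edgeworth_indifference x w d : L <= x -> x <= Rr -> L <= w -> w <= Rr ->
  0 <= d -> `|w - x| <= d ->
  `|r x * F w + x * (1 - F w) - L| <= phih / q L * d.
Proof.
move=> Lx xR Lw wR d0 wx.
have qx := q_gt0 Lx xR; have qL := q_gt0 (lexx L) (ltW LR).
have -> : r x * F w + x * (1 - F w) - L = - (q x * (F w - F x)).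
  have : q x * F x = x - L by rewrite /F /edgeworth_cdf -/(q x) mulrC divfK ?gt_eqF.
  by rewrite /q; lra.
rewrite normrN normrM gtr0_norm// -mulrA; apply: ler_pM => //; first exact: ltW.
  by rewrite lerBlDr (le_trans xR)// (le_trans Rh)// lerDl ltW// residual_gt0.
apply: (@le_trans _ _ ((q L)^-1 * `|w - x|)).
  have [xw|wx'] := leP x w.
    have /andP[h1 h2] := edgeworth_cdf_lipschitz Lx xw wR.
    by rewrite ger0_norm// ger0_norm// subr_ge0.
  have /andP[h1 h2] := edgeworth_cdf_lipschitz Lw (ltW wx') xR.
  by rewrite distrC ger0_norm// distrC ger0_norm// subr_ge0 ltW.
by rewrite ler_pM2l// invr_gt0.
Qed.

(** Opponents below [w] undercut [x] by at least [d]; against the others the full [e x] is conceded.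
    Capping at [Rr] treats prices beyond the support: there [r x <= L] and the mass above
    [w = Rr - d] is at most [d / q L]. *)
Lemma edgeworth_deviation x d w err : w = Num.min x Rr - d ->
  0 <= x -> x <= phih -> 0 < d -> d <= Rr - L ->
  L + d <= x -> 0 <= err ->
  (e * Num.max 0 (r x) + err) * F w + e * x * (1 - F w)
    <= e * L + e * (phih / q L * d) + err.
Proof.
move=> wE x0 xh d0 dR Ldx err0.
have qL := q_gt0 (lexx L) (ltW LR).
have Lw : L <= w by rewrite wE lerBrDr le_min Ldx /=; lra.
have wR : w <= Rr.
  by rewrite wE lerBlDr (le_trans (_ : _ <= Rr)) ?ge_min ?lexx ?orbT// lerDl ltW.
have /andP[F0 F1] := edgeworth_cdf_itv Lw wR.
have errF : err * F w <= err by rewrite ler_piMr.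
suff : e * (Num.max 0 (r x) * F w + x * (1 - F w)) <= e * (L + phih / q L * d) by lra.
rewrite ler_pM2l//; have [xR|Rx] := leP x Rr.
  have Lx : L <= x by lra.
  rewrite (min_idPl xR) in wE.
  have := edgeworth_indifference Lx xR Lw wR (ltW d0).
  rewrite {1}wE addrAC subrr add0r normrN gtr0_norm// => /(_ (lexx d)).
  by rewrite (max_idPr (ltW (residual_gt0 Lx xR))) => /ler_normlP[_]; lra.
rewrite (min_idPr (ltW Rx)) in wE.
have /andP[_] := edgeworth_cdf_lipschitz Lw wR (lexx Rr).
have wd : Rr - w = d by lra.
rewrite edgeworth_cdfR wd => h.
have rx : Num.max 0 (r x) <= L by rewrite ge_max (ltW L_gt0)/= r_le.
have h1 : Num.max 0 (r x) * F w <= L * F w by rewrite ler_wpM2r.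
have h2 : x * (1 - F w) <= phih * ((q L)^-1 * d) by apply: ler_pM => //; lra.
have h3 : L * F w <= L by rewrite ler_piMr// ltW.
lra.
Qed.

End EdgeworthCdf.

(** * Bounds on expected payoffs *)

Section Integral.
Local Open Scope ereal_scope.

(* Unlike the library version, no measurability is required: the integral of a
   nonnegative function is a supremum over the simple functions below it. *)
Lemma le_integral_nonmeas d (T : measurableType d) (R : realType)
    (m : {measure set T -> \bar R}) (D : set T) (f1 f2 : T -> \bar R) :
  (forall x, D x -> 0 <= f1 x) -> (forall x, D x -> f1 x <= f2 x) ->
  \int[m]_(x in D) f1 x <= \int[m]_(x in D) f2 x.
Proof.
move=> f10 f12; have f20 x : D x -> 0 <= f2 x.
  by move=> Dx; exact: le_trans (f10 x Dx) (f12 x Dx).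
rewrite !ge0_integralE//; apply: le_ereal_sup => _ [h /= hf <-]; exists h => //=.
move=> x; apply: le_trans (hf x) _; rewrite /patch; case: ifPn => //.
by rewrite inE => /f12.
Qed.

Variable R : realType.
Implicit Types (a b w : R) (s : probability (measurableTypeR R) R).

Lemma measurable_itvR (i : interval R) : measurable ([set` i] : set (measurableTypeR R)).
Proof. exact: measurable_itv. Qed.

Lemma itv_cc_split a w b : (a <= w)%R -> (w <= b)%R ->
  `[a, b]%classic = `[a, w]%classic `|` `]w, b]%classic :> set R.
Proof.
move=> aw wb; apply/seteqP; split => x; rewrite /= !in_itv /=.
  by move=> /andP[ax xb]; have [xw|wx] := leP x w; [left|right]; rewrite ?ax ?xb.
by case=> /andP[h1 h2]; apply/andP; split; lra.
Qed.

Lemma prob_oc s a w b p : (a <= w)%R -> (w <= b)%R -> s `[a, b]%classic = 1 ->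
  s `[a, w]%classic = p%:E -> s `]w, b]%classic = (1 - p)%:E.
Proof.
move=> aw wb sab saw.
have h : s `[a, b]%classic = s `[a, w]%classic + s `]w, b]%classic.
  rewrite (itv_cc_split aw wb); apply: measureU; try exact: measurable_itvR.
  apply/seteqP; split => // x [] /=; rewrite !in_itv /=.
  by move=> /andP[_ h1] /andP[h2 _]; move: h2; rewrite ltNge h1.
rewrite sab saw in h.
by rewrite EFinB h addeAC subee ?add0e.
Qed.

Lemma integral_scale_indic d (T : measurableType d) (m : {measure set T -> \bar R})
    (A : set T) (c : R) : measurable A -> (0 <= c)%R ->
  \int[m]_x (c%:E * (\1_A x)%:E) = c%:E * m A.
Proof.
move=> mA c0; rewrite ge0_integralZl_EFin ?integral_indic ?setIT//.
exact/measurable_EFinP.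
Qed.

(** [h] need not be measurable: it is dominated by the step function worth [B] on [[a, w]], [C] on
    []w, b]] and [K] on the null complement. *)
Lemma integral_le_step s (D : set R) (h : R -> R) a w b p (B C K : R) :
  (a <= w)%R -> (w <= b)%R -> s `[a, b]%classic = 1 -> s `[a, w]%classic = p%:E ->
  (0 <= B)%R -> (0 <= C)%R -> (0 <= K)%R ->
  (forall y, D y -> 0 <= h y <= K)%R ->
  (forall y, D y -> a <= y <= w -> h y <= B)%R ->
  (forall y, D y -> w < y <= b -> h y <= C)%R ->
  \int[s]_(y in D) (h y)%:E <= (B * p + C * (1 - p))%:E.
Proof.
move=> aw wb sab saw B0 C0 K0 hK hB hC.
pose N : set (measurableTypeR R) := ~` `[a, b]%classic.
have mN : measurable N by apply: measurableC; exact: measurable_itvR.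
have sN : s N = 0 by rewrite /N probability_setC ?sab ?subee//; exact: measurable_itvR.
pose g y := B%:E * (\1_(`[a, w]%classic) y)%:E + C%:E * (\1_(`]w, b]%classic) y)%:E
  + K%:E * (\1_N y)%:E.
have mg (c : R) (A : set (measurableTypeR R)) : measurable A ->
    measurable_fun [set: measurableTypeR R] (fun y => c%:E * (\1_A y)%:E).
  by move=> mA; apply: measurable_funeM; exact/measurable_EFinP.
have g0 (c : R) (A : set (measurableTypeR R)) y : (0 <= c)%R -> 0 <= c%:E * (\1_A y)%:E.
  by move=> c0; rewrite mule_ge0// lee_fin.
have gE : \int[s]_y g y = (B * p + C * (1 - p))%:E.
  rewrite /g ge0_integralD//=.
  - rewrite ge0_integralD//=;
      try by [move=> *; exact: g0 | exact: mg (measurable_itvR _)].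
    have sI (c : R) (A : set (measurableTypeR R)) : measurable A -> (0 <= c)%R ->
        \int[s]_y (c%:E * (\1_A y)%:E) = c%:E * s A.
      exact: integral_scale_indic.
    rewrite !sI//; try exact: measurable_itvR.
    by rewrite sN mule0 adde0 saw (prob_oc aw wb sab saw).
  - by move=> y _; rewrite adde_ge0// g0.
  - by apply: emeasurable_funD; apply: mg; exact: measurable_itvR.
  - by move=> y _; exact: g0.
  - exact: mg.
rewrite -gE integral_mkcond; apply: le_integral_nonmeas => y _.
  by rewrite /patch; case: ifPn => //; rewrite inE => /hK /andP[? _]; rewrite lee_fin.
rewrite /patch; case: ifPn => [|_]; last by rewrite /g !adde_ge0// g0.
rewrite inE => Dy; have /andP[h0 hKy] := hK y Dy.
rewrite /g -!EFinM -!EFinD lee_fin.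
have ind (A : set (measurableTypeR R)) : A y -> (\1_A y = 1 :> R)%R.
  by move=> Ay; rewrite indicE mem_set.
have t1 : (0 <= B * \1_(`[a, w]%classic) y)%R by rewrite mulr_ge0.
have t2 : (0 <= C * \1_(`]w, b]%classic) y)%R by rewrite mulr_ge0.
have t3 : (0 <= K * \1_N y)%R by rewrite mulr_ge0.
have [yw|nyw] := boolP (a <= y <= w)%R.
  have := hB y Dy yw; move: t1; rewrite (ind `[a, w]%classic); last by rewrite /= in_itv.
  by move: t2 t3 => /=; lra.
have [yb|nyb] := boolP (w < y <= b)%R.
  have := hC y Dy yb; move: t2; rewrite (ind `]w, b]%classic); last by rewrite /= in_itv.
  by move: t1 t3 => /=; lra.
have Ny : N y.
  rewrite /N (itv_cc_split aw wb) /= !in_itv /= => -[h1|h1].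
    by rewrite h1 in nyw.
  by rewrite h1 in nyb.
move: t3; rewrite (ind N Ny); lra.
Qed.

Section DoubleIntegral.
Variables (s : probability (measurableTypeR R) R) (D : set R) (h : R -> R -> R).
Variables (a b d c : R) (A B : R -> R).
Hypotheses (ab : (a <= b)%R) (d_ge0 : (0 <= d)%R) (c_ge0 : (0 <= c)%R).
Hypothesis sab : s `[a, b]%classic = 1.
Hypothesis abD : `[a, b]%classic `<=` D.
Hypotheses (mA : measurable_fun (`[a, b]%classic : set (measurableTypeR R)) A)
  (mB : measurable_fun (`[a, b]%classic : set (measurableTypeR R)) B).
Hypotheses (A_ge0 : forall x, (a <= x <= b -> 0 <= A x)%R)
  (B_ge0 : forall x, (a <= x <= b -> 0 <= B x)%R)
  (h_ge0 : forall x y, D x -> D y -> (0 <= h x y)%R)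
  (A_le_h : forall x y, (a <= x <= b -> a <= y <= b -> x + d < y -> A x <= h x y)%R)
  (B_le_h : forall x y, (a <= x <= b -> a <= y <= b -> y <= x + d -> B x <= h x y)%R)
  (c_le : forall x, (a <= x <= b)%R -> exists2 p : R,
     s `[a, Num.min (x + d)%R b]%classic = p%:E & (c <= A x * (1 - p) + B x * p)%R).

Let I : set (measurableTypeR R) := `[a, b]%classic.
Let T := (measurableTypeR R * measurableTypeR R)%type.
Let S1 : set T := [set z | I z.1 /\ I z.2 /\ (z.1 + d < z.2)%R].
Let S2 : set T := [set z | I z.1 /\ I z.2 /\ (z.2 <= z.1 + d)%R].
(** A measurable minorant of [h]: [A] where the opponent's price is higher by more than [d], [B] on
    the rest of the square, 0 outside. Tonelli is applied to [g], never to [h]. *)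
Let g (z : T) : \bar R :=
  ((A \_ I) z.1)%:E * (\1_S1 z)%:E + ((B \_ I) z.1)%:E * (\1_S2 z)%:E.

Let mI : measurable I.
Proof. exact: measurable_itvR. Qed.

Let m_lt : measurable [set z : T | (z.1 + d < z.2)%R].
Proof.
have mf : measurable_fun [set: T] (fun z : T => (z.1 + d < z.2)%R).
  apply: (@measurable_fun_ltr _ _ _ _ (fun z : T => (z.1 + d)%R) (fun z : T => z.2 : R)).
    by apply: measurable_funD => //; exact: measurable_fst.
  exact: measurable_snd.
have -> : [set z : T | (z.1 + d < z.2)%R]
    = [set: T] `&` (fun z : T => (z.1 + d < z.2)%R) @^-1` [set true].
  by apply/seteqP; split => z /=; [move=> ->|case].
exact: mf.
Qed.

Let mS1 : measurable S1.
Proof.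
have -> : S1 =
    (fst @^-1` I) `&` ((snd @^-1` I) `&` [set z : T | (z.1 + d < z.2)%R]) by [].
apply: measurableI; first by rewrite -[X in measurable X]setTI; exact: measurable_fst.
apply: measurableI => //.
by rewrite -[X in measurable X]setTI; exact: measurable_snd.
Qed.

Let mS2 : measurable S2.
Proof.
have -> : S2 = (fst @^-1` I) `&` ((snd @^-1` I) `&` ~` [set z : T | (z.1 + d < z.2)%R]).
  apply/seteqP; split => z /=; rewrite /S2 /=.
    by move=> [? [? /= h1]]; split => //; split => //; apply/negP; rewrite -leNgt.
  by move=> [? [? /negP h1]]; split => //; split => //; rewrite leNgt.
apply: measurableI; first by rewrite -[X in measurable X]setTI; exact: measurable_fst.
apply: measurableI; last exact: measurableC.
by rewrite -[X in measurable X]setTI; exact: measurable_snd.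
Qed.

Let patch_ge0 (F : R -> R) x : (forall y, (a <= y <= b -> 0 <= F y)%R) ->
  (0 <= (F \_ I) x)%R.
Proof.
move=> F0; rewrite /patch; case: ifPn => //; rewrite inE /I /= in_itv /=.
exact: F0.
Qed.

Let g_ge0 z : 0 <= g z.
Proof. by rewrite /g adde_ge0// mule_ge0// lee_fin// patch_ge0. Qed.

Let mg : measurable_fun [set: T] g.
Proof.
have mF (F : R -> R) (S : set T) : measurable_fun I F -> measurable S ->
    measurable_fun [set: T] (fun z : T => ((F \_ I) z.1)%:E * (\1_S z)%:E).
  move=> mF mS; apply: emeasurable_funM; apply/measurable_EFinP => //.
  apply: (measurableT_comp (f := F \_ I)); last exact: measurable_fst.
  exact: (measurable_restrictT F mI).1 mF.
by apply: emeasurable_funD; apply: mF.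
Qed.

Let inner x : (c * \1_I x)%:E <= \int[s]_y g (x, y).
Proof.
have [Ix|nIx] := boolP (x \in I); last first.
  by rewrite indicE (negbTE nIx) mulr0; apply: integral_ge0 => y _; exact: g_ge0.
have xI : I x by rewrite inE in Ix.
have xab : (a <= x <= b)%R by move: xI; rewrite /I /= in_itv.
rewrite indicE Ix mulr1; have [p sp cp] := c_le xab.
pose w := Num.min (x + d)%R b.
have aw : (a <= w)%R.
  by rewrite le_min ab andbT; case/andP: xab => ax _; rewrite (le_trans ax)// lerDl.
have wb : (w <= b)%R by rewrite ge_min lexx orbT.
have gE y : g (x, y) = (A x)%:E * (\1_(`]w, b]%classic) y)%:E
    + (B x)%:E * (\1_(`[a, w]%classic) y)%:E.
  rewrite /g /= /patch Ix; congr (_ * _%:E + _ * _%:E); rewrite !indicE;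
    congr (_%:R)%R; congr (nat_of_bool _).
    apply/idP/idP; rewrite !inE /S1 /I /= !in_itv /=.
      move=> [_ [/andP[_ yb] xy]]; rewrite yb andbT gt_min xy//.
    move=> /andP[wy yb]; split; [exact: xab | split].
      by rewrite yb andbT (le_trans aw)// ltW.
    by move: wy; rewrite gt_min => /orP[//|]; rewrite ltNge yb.
  apply/idP/idP; rewrite !inE /S2 /I /= !in_itv /=.
    by move=> [_ [/andP[ay yb] xy]]; rewrite ay le_min xy yb.
  move=> /andP[ay]; rewrite le_min => /andP[yx yb].
  by split; [exact: xab | rewrite ay yb].
under eq_integral do rewrite gE.
have mf (k : R) (S : set (measurableTypeR R)) : measurable S ->
    measurable_fun [set: measurableTypeR R] (fun y => k%:E * (\1_S y)%:E).
  by move=> mS; apply: measurable_funeM; exact/measurable_EFinP.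
have A0 := A_ge0 xab; have B0 := B_ge0 xab.
rewrite ge0_integralD//=; last 4 first.
- by move=> y _; rewrite mule_ge0// lee_fin.
- by apply: mf; exact: measurable_itvR.
- by move=> y _; rewrite mule_ge0// lee_fin.
- by apply: mf; exact: measurable_itvR.
have sI (k : R) (S : set (measurableTypeR R)) : measurable S -> (0 <= k)%R ->
    \int[s]_y (k%:E * (\1_S y)%:E) = k%:E * s S.
  exact: integral_scale_indic.
rewrite !sI//; try exact: measurable_itvR.
by rewrite sp (prob_oc aw wb sab sp) -!EFinM -EFinD lee_fin.
Qed.

Let g_le_h (x y : R) : D x -> D y -> g (x, y) <= (h x y)%:E.
Proof.
move=> Dx Dy; have h0 := h_ge0 Dx Dy.
rewrite /g /= -!EFinM -EFinD lee_fin !indicE.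
have [Ix|nIx] := boolP (x \in I); last first.
  by rewrite /patch (negbTE nIx) !mul0r addr0.
rewrite /patch Ix; have xI : I x by rewrite inE in Ix.
have xab : (a <= x <= b)%R by move: xI; rewrite /I /= in_itv.
have [Iy|nIy] := boolP (y \in I); last first.
  rewrite (_ : _ \in S1 = false); last first.
    by apply/negbTE/negP; rewrite inE => -[_ [Iy _]]; rewrite mem_set in nIy.
  rewrite (_ : _ \in S2 = false); last first.
    by apply/negbTE/negP; rewrite inE => -[_ [Iy _]]; rewrite mem_set in nIy.
  by rewrite !mulr0 addr0.
have yI : I y by rewrite inE in Iy.
have yab : (a <= y <= b)%R by move: yI; rewrite /I /= in_itv.
have [yx|xy] := leP y (x + d)%R.
  rewrite (_ : _ \in S1 = false) ?mulr0 ?add0r; last first.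
    by apply/negbTE/negP; rewrite inE => -[_ [_ /=]]; rewrite ltNge yx.
  by rewrite mem_set// mulr1 B_le_h.
rewrite mem_set// mulr1 (_ : _ \in S2 = false) ?mulr0 ?addr0 ?A_le_h//.
by apply/negbTE/negP; rewrite inE => -[_ [_ /=]]; rewrite leNgt xy.
Qed.

Let c_le_iterated : c%:E <= \int[s]_x \int[s]_y g (x, y).
Proof.
have <- : \int[s]_x (c%:E * (\1_I x)%:E) = c%:E.
  have -> : \int[s]_x (c%:E * (\1_I x)%:E) = c%:E * s `[a, b]%classic.
    exact: integral_scale_indic.
  by rewrite sab mule1.
apply: le_integral_nonmeas => x _; first by rewrite mule_ge0// lee_fin.
exact: inner.
Qed.

Let g_le_patch z : g z <= ((fun z => (h z.1 z.2)%:E) \_ (D `*` D)) z.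
Proof.
rewrite /patch; case: ifPn => [|nDz].
  by case: z => x y; rewrite inE => -[/= Dx Dy]; exact: g_le_h.
have nS (P : R -> R -> bool) (S : set T) :
    S = [set z | I z.1 /\ I z.2 /\ P z.1 z.2] -> \1_S z = 0%R :> R.
  move=> ->; rewrite indicE; apply/eqP; rewrite pnatr_eq0 eqb0.
  apply: contra nDz; rewrite !inE /= => -[I1 [I2 _]].
  by split; apply: abD.
rewrite /g (nS (fun x y => x + d < y)%R)// (nS (fun x y => y <= x + d)%R)//.
by rewrite !mule0 adde0.
Qed.

Lemma double_integral_ge1 :
  c%:E <= \int[(s \x s)]_(z in D `*` D) (h z.1 z.2)%:E.
Proof.
apply: le_trans c_le_iterated _.
rewrite -(fubini_tonelli1 (m1 := s) (m2 := s) g)// [leRHS]integral_mkcond.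
by apply: le_integral_nonmeas => z _.
Qed.

(** For the second player the minorant is composed with the swap of coordinates and integrated in
    the other order, which restores the same iterated integral. *)
Lemma double_integral_ge2 :
  c%:E <= \int[(s \x s)]_(z in D `*` D) (h z.2 z.1)%:E.
Proof.
apply: le_trans c_le_iterated _.
pose sw (z : T) : T := (z.2, z.1).
have mg' : measurable_fun [set: T] (g \o sw).
  apply: measurableT_comp mg _; exact: measurable_swap.
rewrite -(fubini_tonelli2 (m1 := s) (m2 := s) (g \o sw))// => [|z]; last exact: g_ge0.
rewrite [leRHS]integral_mkcond; apply: le_integral_nonmeas => z _; first exact: g_ge0.
apply: le_trans (g_le_patch (sw z)) _; rewrite /patch.
by have -> : (sw z \in D `*` D) = (z \in D `*` D) by rewrite !in_setX andbC.
Qed.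

End DoubleIntegral.
End Integral.

(** * A probability with a prescribed Lipschitz distribution function *)

Section ProbabilityOfCdf.
Variables (R : realType) (F : R -> R) (a b k : R).
Hypotheses (ab : a < b)
  (F_le : forall x y, a <= x -> x <= y -> y <= b -> 0 <= F y - F x <= k * (y - x))
  (Fa : F a = 0) (Fb : F b = 1).

(** Clamping extends [F] to the line by the constants 0 and 1, as a Lebesgue-Stieltjes measure
    requires. *)
Let cl (x : R) := Num.max a (Num.min x b).
Let H := F \o cl.

Let cl_in x : a <= cl x <= b.
Proof.
by rewrite /cl le_max lexx /= ge_max (ltW ab)/= ge_min lexx orbT.
Qed.

Let cl_id x : a <= x <= b -> cl x = x.
Proof. by move=> /andP[ax xb]; rewrite /cl (min_idPl xb) (max_idPr ax). Qed.

Let cl_mono x y : x <= y -> 0 <= cl y - cl x <= y - x.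
Proof.
move=> xy; rewrite /cl; have abx := ab.
case: (leP x b) => xb; case: (leP y b) => yb;
  case: (leP a b) => h0; case: (leP a x) => h1; case: (leP a y) => h2;
  by apply/andP; split; lra.
Qed.

Let k_ge0 : 0 <= k.
Proof.
have := @F_le a b (lexx a) (ltW ab) (lexx b); rewrite Fa Fb subr0 ler01 /= => h.
rewrite -(pmulr_lge0 k (_ : 0 < b - a)) ?subr_gt0//.
exact: le_trans h.
Qed.

Let H_le x y : x <= y -> 0 <= H y - H x <= k * (y - x).
Proof.
move=> xy; have /andP[h1 h2] := cl_mono xy.
have /andP[ax xb] := cl_in x; have /andP[ay yb] := cl_in y.
have cxy : cl x <= cl y by rewrite -subr_ge0.
have /andP[h3 h4] := F_le ax cxy yb.
by rewrite /H /= h3 (le_trans h4)// ler_wpM2l.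
Qed.

Let H_nd : {homo H : x y / x <= y}.
Proof. by move=> x y /H_le/andP[h _]; rewrite -subr_ge0. Qed.

Let H_rc : right_continuous H.
Proof.
move=> x; apply/cvgrPdist_lt => eps eps0.
have d0 : 0 < eps / (k + 1) by rewrite divr_gt0// ltr_wpDl.
rewrite nearE /at_right /within /=; apply/nbhs_normP; exists (eps / (k + 1)) => //= y.
rewrite /ball_ /= => xy lt_xy; have /andP[h1 h2] := H_le (ltW lt_xy).
rewrite distrC ger0_norm//; apply: le_lt_trans h2 _.
move: xy; rewrite distrC gtr0_norm ?subr_gt0// ltr_pdivlMr; last by rewrite ltr_wpDl.
by apply: le_lt_trans; rewrite mulrC ler_wpM2l ?lerDl// subr_ge0 ltW.
Qed.

Let H_Ny : H @ -oo --> (0 : R).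
Proof.
apply: cvg_near_cst; near=> x.
have xa : x <= a by near: x; exact: nbhs_ninfty_le (num_real _).
rewrite /H /= /cl; have xb : x <= b by rewrite (le_trans xa)// ltW.
by rewrite (min_idPl xb) (max_idPl xa) Fa.
Unshelve. all: by end_near. Qed.

Let H_y : H @ +oo --> (1 : R).
Proof.
apply: cvg_near_cst; near=> x.
have xb : b <= x by near: x; exact: nbhs_pinfty_ge (num_real _).
rewrite /H /= /cl (min_idPr xb).
by rewrite (max_idPr (ltW ab)) Fb.
Unshelve. all: by end_near. Qed.

HB.instance Definition _ := isCumulative.Build R _ R H H_nd H_rc.
HB.instance Definition _ := isCumulativeBounded.Build R 0 1 H H_Ny H_y.

Lemma exists_probability_of_cdf :
  exists s : probability (measurableTypeR R) R, s `[a, b]%classic = 1%E /\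
    forall x, a <= x <= b -> s `[a, x]%classic = (F x)%:E.
Proof.
pose Hc : cumulativeBounded 0 1 := H.
pose s : probability (measurableTypeR R) R := lebesgue_stieltjes_measure Hc.
exists s.
have cdfE x : s `]-oo, x]%classic = (H x)%:E.
  have := cdf_lebesgue_stieltjes_id Hc x.
  by rewrite /cdf /distribution /pushforward preimage_id.
have m (i : interval R) : measurable ([set` i] : set (measurableTypeR R)).
  exact: measurable_itv.
have s0 : s `]-oo, a[%classic = 0%E.
  apply/eqP; rewrite eq_le measure_ge0 andbT.
  have <- : s `]-oo, a]%classic = 0%E.
    by rewrite cdfE /H /= cl_id ?lexx ?(ltW ab)// Fa.
  by apply: le_measure; rewrite ?inE//; apply: subset_itvl; rewrite bnd_simp.
have sE x : a <= x <= b -> s `[a, x]%classic = (F x)%:E.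
  move=> axb; have := cdfE x; rewrite /H /= cl_id// => <-.
  have -> : `]-oo, x]%classic = `]-oo, a[%classic `|` `[a, x]%classic :> set R.
    apply/seteqP; split => y; rewrite /= !in_itv /=.
      by move=> yx; have [ay|ya] := leP a y; [right; rewrite yx | left].
    by case=> [ya|/andP[]//]; case/andP: axb => ax _; rewrite ltW// (lt_le_trans ya).
  have -> : s (`]-oo, a[%classic `|` `[a, x]%classic)
      = (s `]-oo, a[%classic + s `[a, x]%classic)%E.
    apply: measureU => //; apply/seteqP; split => // y [] /=; rewrite !in_itv /=.
    by move=> ya /andP[]; rewrite leNgt ya.
  by rewrite s0 add0e.
split=> //; by rewrite sE ?Fb// (ltW ab) lexx.
Qed.

End ProbabilityOfCdf.

(** * The Wardrop split *)

Section Balance.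
Variables (R : realType) (c k : R) (h1 h2 : R -> R).
Hypotheses (c_gt0 : 0 < c)
  (h1_incr : forall x y, 0 <= x -> x < y -> y <= c -> 0 < h1 y - h1 x <= k * (y - x))
  (h2_incr : forall x y, 0 <= x -> x < y -> y <= c -> 0 < h2 y - h2 x <= k * (y - x)).

Let gap x := h1 x - h2 (c - x).

Let k_gt0 : 0 < k.
Proof.
have /andP[h h'] := h1_incr (lexx 0) c_gt0 (lexx c).
by have := lt_le_trans h h'; rewrite subr0 pmulr_lgt0.
Qed.

Let gap_incr x y : 0 <= x -> x < y -> y <= c -> 0 < gap y - gap x <= 2 * k * (y - x).
Proof.
move=> x0 xy yc; have /andP[a1 a2] := h1_incr x0 xy yc.
have /andP[b1 b2] := @h2_incr (c - y) (c - x) ltac:(lra) ltac:(lra) ltac:(lra).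
by rewrite /gap; apply/andP; split; lra.
Qed.

Let gap_dist x y : 0 <= x <= c -> 0 <= y <= c -> `|gap y - gap x| <= 2 * k * `|y - x|.
Proof.
move=> /andP[x0 xc] /andP[y0 yc]; have [xy|yx|->] := ltgtP x y.
- have /andP[h h'] := gap_incr x0 xy yc.
  by rewrite gtr0_norm// gtr0_norm// subr_gt0.
- have /andP[h h'] := gap_incr y0 yx xc.
  by rewrite distrC (distrC y) gtr0_norm// gtr0_norm// subr_gt0.
- by rewrite !subrr !normr0 mulr0.
Qed.

Let sq x := gap x ^+ 2.

Let W := argmin `[0, c] sq.

Let W_min : 0 <= W <= c /\ forall x, 0 <= x <= c -> sq W <= sq x.
Proof.
have gap_cont : {within `[0, c], continuous gap}.
  apply: within_continuous_dist => x eps xc eps0.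
  exists (eps / (2 * k)); first by rewrite divr_gt0// mulr_gt0.
  move=> y yc; rewrite ltr_pdivlMr ?mulr_gt0// mulrC.
  by apply: le_lt_trans; exact: gap_dist.
have sq_cont : {within `[0, c], continuous sq}.
  by move=> x; rewrite /sq; apply: cvgM; exact: gap_cont.
have [w wc wmin] := EVT_min (ltW c_gt0) sq_cont.
have : exists x, `[0, c]%classic x /\ forall y, `[0, c]%classic y -> sq x <= sq y.
  by exists w; split=> // y; exact: wmin.
move=> /(@xgetPex _ 0 [set x | `[0, c]%classic x /\
    forall y, `[0, c]%classic y -> sq x <= sq y]) [].
rewrite -/(argmin _ _) -/W /= in_itv /= => Wc h; split=> // x xc; exact: h.
Qed.

(* Moving the split slightly towards balance strictly decreases the square. *)
Lemma argmin_balance : [/\ 0 <= W <= c, 0 < W -> h1 W <= h2 (c - W) &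
  W < c -> h2 (c - W) <= h1 W].
Proof.
have [Wc Wmin] := W_min; have /andP[W0 W1] := Wc.
have k2 : 0 < 2 * k by rewrite mulr_gt0.
split=> // Wlt; rewrite -subr_ge0 -oppr_le0 opprB.
- rewrite -/(gap W) leNgt; apply/negP => gap0.
  (* The gap varies at rate at most [2 k], so a move of this size shrinks it without changing its
     sign. *)
  pose s := Num.min W (gap W / (2 * k)).
  have s0 : 0 < s by rewrite lt_min Wlt divr_gt0.
  have sW : s <= W by rewrite ge_min lexx.
  have sg : s * (2 * k) <= gap W by rewrite -ler_pdivlMr// ge_min lexx orbT.
  have /andP[h h'] := @gap_incr (W - s) W ltac:(lra) ltac:(lra) W1.
  have := Wmin (W - s); move=> /(_ ltac:(apply/andP; split; lra)).
  rewrite /sq ler_sqr ?nnegrE ?(ltW gap0)//; last by lra.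
  lra.
- rewrite -opprB -/(gap W) oppr_le0 leNgt; apply/negP => gap0.
  pose s := Num.min (c - W) (- gap W / (2 * k)).
  have s0 : 0 < s by rewrite lt_min subr_gt0 Wlt divr_gt0// oppr_gt0.
  have sW : s <= c - W by rewrite ge_min lexx.
  have sg : s * (2 * k) <= - gap W by rewrite -ler_pdivlMr// ge_min lexx orbT.
  have /andP[h h'] := @gap_incr W (W + s) W0 ltac:(lra) ltac:(lra).
  have := Wmin (W + s); move=> /(_ ltac:(apply/andP; split; lra)).
  rewrite /sq -sqrrN -[leRHS]sqrrN ler_sqr ?nnegrE; [|lra|lra].
  lra.
Qed.

End Balance.

(** This is [1 - calD] as a function of the demand [l] (see [calDE]), so comparing values of [calD]
    amounts to comparing acceptances in reverse. *)
Definition accepted (R : realType) (f G : R -> R) (x l : R) : R :=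
  f x * (1 - G (l * f x)).

Section Split.
Variables (R : realType) (phih : R) (f : R -> R) (Lam e beta alpha : R) (N : nat).
Hypotheses (Lam_gt0 : 0 < Lam) (e_gt0 : 0 < e) (beta_gt0 : 0 < beta)
  (alpha_gt0 : 0 < alpha) (alpha_lt1 : alpha < 1) (N_gt0 : (0 < N)%N)
  (f_gt0 : forall x, 0 <= x -> x <= phih -> 0 < f x)
  (f_le1 : forall x, 0 <= x -> x <= phih -> f x <= 1).

Let G := score e beta alpha N.
Let D := calD f e N beta alpha.

Lemma calDE x l : D x l = 1 - f x * (1 - G (l * f x)).
Proof.
rewrite /D /calD /G /score /score_num -/(nu_total e beta (l * f x)) /calU.
rewrite -/(nu_total e beta (l * f x)) -/(nu e beta (l * f x)).
by rewrite /mu -/(nu e beta _) -/(nu_total e beta _); ring.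
Qed.

Lemma calD_incr x l m : 0 <= x -> x <= phih -> 0 <= l -> l < m ->
  0 < D x m - D x l <= e / beta / beta * nu_total e beta 0 * (m - l).
Proof.
move=> x0 xh l0 lm; have fx := f_gt0 x0 xh; have fx1 := f_le1 x0 xh.
have t0 : 0 <= l * f x by rewrite mulr_ge0// ltW.
have tt : l * f x < m * f x by rewrite ltr_pM2r.
have G1 := score_incr e_gt0 beta_gt0 alpha_gt0 alpha_lt1 N_gt0 t0 tt.
have G2 := score_lipschitz e_gt0 beta_gt0 N alpha_gt0 alpha_lt1 t0 (ltW tt).
rewrite !calDE; have -> : 1 - f x * (1 - G (m * f x)) - (1 - f x * (1 - G (l * f x)))
  = f x * (G (m * f x) - G (l * f x)) by ring.
rewrite mulr_gt0 ?subr_gt0//=.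
have G0 : 0 <= G (m * f x) - G (l * f x) by rewrite subr_ge0 ltW.
apply: (@le_trans _ _ (1 * (G (m * f x) - G (l * f x)))).
  by rewrite ler_wpM2r.
rewrite mul1r; apply: le_trans G2 _; rewrite -mulrBl ler_wpM2l//.
  apply: mulr_ge0; first by rewrite !divr_ge0// ltW.
  by rewrite ltW// nu_total_gt0.
by rewrite ler_piMr// subr_ge0 ltW.
Qed.

(** The only access of the later estimates to the split. For [platform2] the demand is [Lam - w],
    and the two one-sided conditions exchange their roles. *)
Lemma own_split i x y : 0 <= x -> x <= phih -> 0 <= y -> y <= phih ->
  exists l, [/\ 0 <= l <= Lam,
    own (calM f Lam e N beta alpha) i x y
      = x * (l * f x * (1 - idle e beta (l * f x))),
    0 < l -> accepted f G y (Lam - l) <= accepted f G x l &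
    l < Lam -> accepted f G x l <= accepted f G y (Lam - l)].
Proof.
move=> x0 xh y0 yh.
have incr z : 0 <= z -> z <= phih -> forall l m, 0 <= l -> l < m -> m <= Lam ->
    0 < D z m - D z l <= e / beta / beta * nu_total e beta 0 * (m - l).
  by move=> z0 zh l m l0 lm _; exact: calD_incr.
have acc z u l m : (D z l <= D u m) = (accepted f G u m <= accepted f G z l).
  by rewrite !calDE lerD2l lerN2.
case: i => /=.
  have [] := argmin_balance Lam_gt0 (incr x x0 xh) (incr y y0 yh).
  rewrite -/(wardrop1 f Lam e N beta alpha x y) => wL w1 w2.
  exists (wardrop1 f Lam e N beta alpha x y); split=> //; try by rewrite -acc.
  by rewrite /calM /=; rewrite /idle /calU; ring.
have [] := argmin_balance Lam_gt0 (incr y y0 yh) (incr x x0 xh).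
rewrite -/(wardrop1 f Lam e N beta alpha y x).
set w := wardrop1 _ _ _ _ _ _ _ _ => /andP[w0 wL] w1 w2.
exists (Lam - w); rewrite subKr; split; try rewrite -acc.
- by apply/andP; split; lra.
- by rewrite /calM /= -/w /idle /calU; ring.
- by rewrite subr_gt0; exact: w2.
- by rewrite gtrBl; exact: w1.
Qed.

End Split.

(** * The game near the fluid limit *)

(* [U] and [G] abstract [idle] and [score]: the hypotheses say that [U t] is
   [max 0 (1 - e / t)] up to [delta], and [G] is [U] up to [alpha]. *)
Section Duopoly.
Variables (R : realType) (phih : R) (f : R -> R) (Lam e alpha delta : R).
Variables (U G : R -> R) (M : platform -> R -> R -> R).
Hypotheses (Lam_gt0 : 0 < Lam) (e_gt0 : 0 < e)
  (alpha_gt0 : 0 < alpha) (delta_gt0 : 0 < delta)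
  (f_noninc : forall x y, 0 <= x -> x <= y -> y <= phih -> f y <= f x)
  (f_gt0 : forall x, 0 <= x -> x <= phih -> 0 < f x)
  (f_le1 : forall x, 0 <= x -> x <= phih -> f x <= 1)
  (U_ge0 : forall t, 0 <= t -> 0 <= U t)
  (U_le_G : forall t, 0 <= t -> U t <= G t)
  (G_le_U : forall t, 0 <= t -> G t <= U t + alpha)
  (G_le1 : forall t, 0 <= t -> G t <= 1)
  (G_incr : forall s t, 0 <= s -> s < t -> G s < G t)
  (served_le_e : forall t, 0 <= t -> t * (1 - U t) <= e)
  (U_underload : forall t, 0 <= t <= e -> U t <= delta)
  (U_overload : forall t, e <= t -> t * U t <= t - e + delta * e).

Hypothesis own_split : forall i x y, 0 <= x -> x <= phih -> 0 <= y -> y <= phih ->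
  exists l, [/\ 0 <= l <= Lam, own M i x y = x * (l * f x * (1 - U (l * f x))),
    0 < l -> accepted f G y (Lam - l) <= accepted f G x l &
    l < Lam -> accepted f G x l <= accepted f G y (Lam - l)].

(** [kappa] bounds the acceptance lost by an underloaded platform, and [err] the error of a payoff
    at any price, the load being at most [Lam]. *)
Let kappa := alpha + delta.
Let err := phih * (kappa * Lam + delta * e).

Let load_ge0 x l : 0 <= x -> x <= phih -> 0 <= l -> 0 <= l * f x.
Proof. by move=> x0 xh l0; rewrite mulr_ge0// ltW// f_gt0. Qed.

Let U_le1 t : 0 <= t -> U t <= 1.
Proof. by move=> t0; rewrite (le_trans (U_le_G t0))// G_le1. Qed.

Let served_overload t : e <= t -> e - delta * e <= t * (1 - U t).
Proof. by move=> /U_overload; rewrite mulrBr mulr1; lra. Qed.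

Let accepted_le x l : 0 <= x -> x <= phih -> 0 <= l ->
  accepted f G x l <= f x * (1 - U (l * f x)).
Proof.
move=> x0 xh l0; rewrite ler_pM2l ?f_gt0// lerD2l lerN2.
by apply: U_le_G; exact: load_ge0.
Qed.

Let accepted_le_f x l : 0 <= x -> x <= phih -> 0 <= l -> accepted f G x l <= f x.
Proof.
move=> x0 xh l0; rewrite ler_piMr ?(ltW (f_gt0 x0 xh))// gerBl.
have t0 := load_ge0 x0 xh l0.
exact: le_trans (U_ge0 t0) (U_le_G t0).
Qed.

Let accepted_underload x l : 0 <= x -> x <= phih -> 0 <= l -> l * f x <= e ->
  f x * (1 - kappa) <= accepted f G x l.
Proof.
move=> x0 xh l0 te; rewrite ler_pM2l ?f_gt0//.
have t0 := load_ge0 x0 xh l0.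
have := G_le_U t0; have := @U_underload (l * f x); rewrite t0 te => /(_ isT).
rewrite /kappa; lra.
Qed.

Let kappaLam : 0 < kappa * Lam.
Proof. by rewrite mulr_gt0// addr_gt0. Qed.
Let deltaLam : 0 < delta * Lam.
Proof. by rewrite mulr_gt0. Qed.
Let deltae : 0 < delta * e.
Proof. by rewrite mulr_gt0. Qed.

Let err_ge x c : 0 <= x -> x <= phih -> c <= kappa * Lam + delta * e ->
  x * c <= err.
Proof.
move=> x0 xh cE; apply: (@le_trans _ _ (x * (kappa * Lam + delta * e))).
  by rewrite ler_wpM2l.
by rewrite ler_wpM2r// ltW// addr_gt0.
Qed.

Lemma payoff_ge0 i x y : 0 <= x -> x <= phih -> 0 <= y -> y <= phih -> 0 <= own M i x y.
Proof.
move=> x0 xh y0 yh; have [l [/andP[l0 _] -> _ _]] := own_split i x0 xh y0 yh.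
have t0 := load_ge0 x0 xh l0.
by rewrite mulr_ge0// mulr_ge0// subr_ge0 U_le1.
Qed.

Lemma payoff_le i x y : 0 <= x -> x <= phih -> 0 <= y -> y <= phih ->
  own M i x y <= e * x.
Proof.
move=> x0 xh y0 yh; have [l [/andP[l0 _] -> _ _]] := own_split i x0 xh y0 yh.
rewrite mulrC ler_wpM2r//; apply: served_le_e; exact: load_ge0.
Qed.

Lemma payoff_le_load x l : 0 <= x -> x <= phih -> 0 <= l ->
  x * (l * f x * (1 - U (l * f x))) <= x * (l * f x).
Proof.
move=> x0 xh l0; have t0 := load_ge0 x0 xh l0.
by rewrite ler_wpM2l// ler_piMr// gerBl U_ge0.
Qed.

(** With [l > 0] the rival accepts at most [f x]. In underload it would accept at least
    [f y (1 - kappa) > f x], so it is overloaded, serves nearly [e], and [(Lam - l) f x] is at least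
    about [e]. The maximum with 0 covers [l = 0]. *)
Lemma overpriced_le i x y : 0 <= x -> x <= phih -> 0 <= y -> y <= phih ->
  f x + kappa < f y -> own M i x y <= e * Num.max 0 (residual f Lam e x) + err.
Proof.
move=> x0 xh y0 yh gap; have [l [/andP[l0 lL] -> H _]] := own_split i x0 xh y0 yh.
have r0 : 0 <= e * Num.max 0 (residual f Lam e x).
  by rewrite mulr_ge0 ?(ltW e_gt0)// le_max lexx.
have err0 : 0 <= err.
  by rewrite -[leLHS](mulr0 x); apply: err_ge => //; apply/ltW/addr_gt0.
move: l0; rewrite le_eqVlt => /orP[/eqP <-|l0].
  by rewrite !mul0r mulr0 addr_ge0.
have fx := f_gt0 x0 xh; have fy := f_gt0 y0 yh; have fy1 := f_le1 y0 yh.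
have m0 : 0 <= Lam - l by rewrite subr_ge0.
have t0 := load_ge0 y0 yh m0.
have accx := accepted_le_f x0 xh (ltW l0).
have accy := le_trans (H l0) accx.
have [te|te] := leP ((Lam - l) * f y) e.
  have := accepted_underload y0 yh m0 te.
  have : f y * kappa <= kappa by rewrite ler_piMl// ltW// addr_gt0.
  lra.
have sv := served_overload (ltW te).
have mfx : e - delta * e - alpha * Lam <= (Lam - l) * f x.
  have tL : (Lam - l) * f y <= Lam by rewrite (le_trans (ler_piMr m0 fy1))// gerBl ltW.
  have := ler_wpM2l m0 accy; rewrite /accepted mulrA.
  move: t0 (G_le_U t0) sv tL; move: ((Lam - l) * f y) => t t0 GU sv tL h.
  have h1 : t * G t <= t * (U t + alpha) by rewrite ler_wpM2l.
  have h2 : t * alpha <= Lam * alpha by rewrite ler_pM2r.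
  lra.
apply: le_trans (payoff_le_load x0 xh (ltW l0)) _.
apply: (@le_trans _ _ (x * (Lam * f x - e) + x * (alpha * Lam + delta * e))).
  rewrite -mulrDr ler_wpM2l//.
  move: mfx; rewrite mulrBl; lra.
apply: lerD.
  by rewrite -residualM// ler_pM2l// le_max lexx orbT.
apply: err_ge => //; have := deltaLam; rewrite /kappa; lra.
Qed.

(** If the load of [x] were below [e], its acceptance would exceed [f y], hence that of the rival,
    which forces [l = Lam] and the load [Lam f x >= e]. *)
Lemma undercut_ge i x y : 0 <= x -> x <= phih -> 0 <= y -> y <= phih ->
  e <= Lam * f x -> f y + kappa < f x -> e * x - err <= own M i x y.
Proof.
move=> x0 xh y0 yh rx gap; have [l [/andP[l0 lL] -> _ H]] := own_split i x0 xh y0 yh.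
have fx := f_gt0 x0 xh; have fx1 := f_le1 x0 xh.
have te : e <= l * f x.
  have [//|te] := leP e (l * f x).
  have h1 := accepted_underload x0 xh l0 (ltW te).
  move: lL; rewrite le_eqVlt => /orP[/eqP lE|lL]; first by move: te; rewrite lE; lra.
  have m0 : 0 <= Lam - l by rewrite subr_ge0 ltW.
  have h2 := accepted_le_f y0 yh m0.
  have h3 := H lL.
  have : f x * kappa <= kappa by rewrite ler_piMl// ltW// addr_gt0.
  lra.
have : x * (e - delta * e) <= x * (l * f x * (1 - U (l * f x))).
  by rewrite ler_wpM2l// served_overload.
have : x * (delta * e) <= err.
    by apply: err_ge => //; have := kappaLam; have := deltae; lra.
lra.
Qed.

(** This holds at every rival price, ties included, which covers pairs less than [d] apart. If
    [(Lam - l) f x] were well above [e], then [x] would be underloaded and accept nearly [f x]; the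
    rival, accepting at least that fraction of [Lam - l], would serve more than [e]. *)
Lemma payoff_ge_residual i x y : 0 <= x -> x <= phih -> 0 <= y -> y <= phih ->
  Lam * f x <= 2 * e -> e * residual f Lam e x - err <= own M i x y.
Proof.
move=> x0 xh y0 yh rx; have [l [/andP[l0 lL] -> _ H]] := own_split i x0 xh y0 yh.
have fx := f_gt0 x0 xh; have fx1 := f_le1 x0 xh.
have t0 := load_ge0 x0 xh l0.
have m0 : 0 <= Lam - l by lra.
have mL : Lam - l <= Lam by lra.
have mfx : (Lam - l) * f x <= e + kappa * Lam.
  rewrite leNgt; apply/negP => lt_m.
  have mp : 0 < Lam - l.
    by rewrite -(pmulr_lgt0 _ fx) (lt_trans _ lt_m)// addr_gt0.
  have h1 := H ltac:(lra).
  have h2 := le_trans h1 (accepted_le y0 yh m0).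
  have h3 : (Lam - l) * accepted f G x l <= e.
    apply: le_trans (served_le_e (load_ge0 y0 yh m0)).
    by rewrite -mulrA ler_wpM2l.
  have te : l * f x <= e by have := kappaLam; lra.
  have h4 : (Lam - l) * (f x * (1 - kappa)) <= e.
    by apply: le_trans h3; rewrite ler_wpM2l// accepted_underload.
  have : (Lam - l) * f x * kappa <= Lam * kappa.
    rewrite ler_wpM2r ?(ltW (addr_gt0 _ _))//.
    by apply: le_trans mL; rewrite ler_piMr.
  lra.
rewrite residualM//.
suff : Lam * f x - e - kappa * Lam - delta * e <= l * f x * (1 - U (l * f x)).
  move=> h; have : x * (Lam * f x - e - kappa * Lam - delta * e)
    <= x * (l * f x * (1 - U (l * f x))) by rewrite ler_wpM2l.
  have : x * (kappa * Lam + delta * e) <= err.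
    by apply: err_ge => //; have := kappaLam; have := deltae; lra.
  lra.
have [te|te] := leP e (l * f x).
  have := kappaLam; have := deltae; have := served_overload te; lra.
have := @U_underload (l * f x); rewrite t0 (ltW te) => /(_ isT) hU.
have : l * f x * U (l * f x) <= e * delta.
  by apply: ler_pM => //; [exact: U_ge0|exact: ltW].
lra.
Qed.

(** A larger load would mean [l > Lam / 2]; the rival, with a smaller load and a larger [f], would
    then accept strictly more, although [x] has positive demand. *)
Lemma overpriced_le_half i x y : 0 <= y -> y <= x -> x <= phih ->
  own M i x y <= x * (f y * (Lam / 2)).
Proof.
move=> y0 yx xh; have x0 := le_trans y0 yx; have yh := le_trans yx xh.
have [l [/andP[l0 lL] -> H _]] := own_split i x0 xh y0 yh.
have fx := f_gt0 x0 xh; have fyx := f_noninc y0 yx xh.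
apply: le_trans (payoff_le_load x0 xh l0) _; rewrite ler_wpM2l//.
rewrite leNgt; apply/negP => lt_t.
have lhalf : Lam / 2 < l.
  rewrite -(ltr_pM2r fx); apply: le_lt_trans lt_t.
  by rewrite mulrC ler_wpM2r//; lra.
have fy : 0 < f y by exact: lt_le_trans fyx.
have ty : (Lam - l) * f y < l * f x.
  by apply: lt_trans lt_t; rewrite mulrC ltr_pM2l//; lra.
have m0 : 0 <= Lam - l by lra.
have := G_incr (load_ge0 y0 yh m0) ty.
have := H (lt_trans _ lhalf); rewrite /accepted.
have L2 : 0 < Lam / 2 by lra.
move=> /(_ L2) h1 h2.
have h3 : f x * (1 - G ((Lam - l) * f y)) <= f y * (1 - G ((Lam - l) * f y)).
  by rewrite ler_wpM2r// subr_ge0 G_le1// load_ge0.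
have : f x * (1 - G (l * f x)) < f x * (1 - G ((Lam - l) * f y)).
  by rewrite ltr_pM2l//; lra.
lra.
Qed.

(** Acceptance strictly decreases in the demand, so at equal prices the two conditions force
    [l = Lam / 2]. *)
Lemma symmetric_ge i x : 0 <= x -> x <= phih -> 2 * e <= Lam * f x ->
  e * x - err <= own M i x x.
Proof.
move=> x0 xh rx; have [l [/andP[l0 lL] -> H1 H2]] := own_split i x0 xh x0 xh.
have fx := f_gt0 x0 xh.
have strict s t : 0 <= s -> s < t -> accepted f G x t < accepted f G x s.
  move=> s0 st; rewrite ltr_pM2l// ltrD2l ltrN2; apply: G_incr.
    exact: load_ge0.
  by rewrite ltr_pM2r.
have lE : l = Lam / 2.
  apply/eqP; rewrite eq_le; apply/andP; split; rewrite leNgt; apply/negP => h.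
    have := H1 ltac:(lra); have := strict (Lam - l) l; move=> /(_ ltac:(lra) ltac:(lra)).
    lra.
  have := H2 ltac:(lra); have := strict l (Lam - l); move=> /(_ ltac:(lra) ltac:(lra)).
  lra.
have te : e <= l * f x by rewrite lE; lra.
have : x * (e - delta * e) <= x * (l * f x * (1 - U (l * f x))).
  by rewrite ler_wpM2l// served_overload.
have : x * (delta * e) <= err.
    by apply: err_ge => //; have := kappaLam; have := deltae; lra.
lra.
Qed.

(** * From payoff bounds to equilibria *)

Section Equilibria.
Variables (d eps : R).
Hypotheses (d_gt0 : 0 < d) (eps_gt0 : 0 < eps) (d_gap : kappa < 1 - f d)
  (f_gap : forall x y c, 0 <= y -> 0 <= c -> y + c <= x -> x <= phih ->
     1 - f c <= f y - f x).

Let r := residual f Lam e.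

Let gapE x y : 0 <= y -> y + d <= x -> x <= phih -> f x + kappa < f y.
Proof. by move=> y0 yx xh; have := f_gap y0 (ltW d_gt0) yx xh; have := d_gap; lra. Qed.

Let pricesE x : prices phih x <-> 0 <= x <= phih.
Proof. by rewrite /prices /= in_itv. Qed.

Let err_ge0 : 0 <= phih -> 0 <= err.
Proof.
by move=> h0; rewrite /err mulr_ge0// ltW// addr_gt0.
Qed.

Lemma pure_equilibrium p : 0 <= p <= phih -> 2 * e <= Lam * f p ->
  (forall x, p < x -> x <= phih -> r x <= p) -> e * d + 2 * err <= eps ->
  pure_eps_nash phih M eps (fun=> p).
Proof.
move=> /andP[p0 ph] fp rp small; split=> [i|i x /pricesE/andP[x0 xh]].
  by apply/pricesE; rewrite p0.
have err0 := err_ge0 (le_trans p0 ph).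
have low := symmetric_ge i p0 ph fp.
have ed : 0 < e * d by rewrite mulr_gt0.
have [px|xp] := leP (p + d) x.
  have h1 := overpriced_le i x0 xh p0 ph (gapE p0 px xh).
  have h2 : e * Num.max 0 (r x) <= e * p.
    by rewrite ler_pM2l// ge_max p0 rp//; have := d_gt0; lra.
  rewrite -/r in h1; lra.
have h1 := payoff_le i x0 xh p0 ph.
have h2 : e * x <= e * (p + d) by rewrite ler_pM2l// ltW.
lra.
Qed.

Section Edgeworth.
Variables (L Rr : R).
Hypotheses (L_gt0 : 0 < L) (LR : L < Rr) (Rh : Rr <= phih)
  (fL : Lam * f L < 2 * e) (fR : e < Lam * f Rr)
  (r_le : forall x, 0 <= x -> x <= phih -> r x <= L).

Let phih_ge0 : 0 <= phih.
Proof. exact: le_trans (ltW (lt_trans L_gt0 LR)) Rh. Qed.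

Section Cycle.
Hypotheses (d_eps : d < eps)
  (small1 : e * d + 2 * err < e * eps)
  (small2 : e * d + err + d * (f L * (Lam / 2)) < (e - f L * (Lam / 2)) * L).

(** The reply earns about [e (y - d)] with [y >= L + eps]. Its margin is [e eps] against prices
    whose payoff is about [e L] or less, and [(e - f L Lam / 2) L] against prices within [d] above
    [y]; [small1] and [small2] fit the errors into these margins. *)
Lemma undercut_beats i y z : L + eps <= y -> y <= Rr - eps ->
  0 <= z -> z <= phih -> (y <= z) || (z <= L) ->
  own M i z y < own M i (y - d) y.
Proof.
move=> Ly yR z0 zh zcases.
have d0 := d_gt0; have e0 := eps_gt0; have L0 := L_gt0; have de := d_eps.
have rh := Rh; have lr := LR.
have yd0 : 0 <= y - d by lra.
have ydh : y - d <= phih by lra.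
have y0 : 0 <= y by lra.
have yh : y <= phih by lra.
have ed := mulr_gt0 e_gt0 d_gt0.
have err0 := err_ge0 phih_ge0.
have low : e * (y - d) - err <= own M i (y - d) y.
  apply: undercut_ge => //; last by apply: gapE; rewrite ?subrK.
  apply: le_trans (ltW fR) _; rewrite ler_pM2l// f_noninc//; lra.
have eL : e * L + e * eps <= e * y by rewrite -mulrDr ler_pM2l.
have sm1 := small1.
move: zcases => /orP[yz|zL]; last first.
  have h1 := payoff_le i z0 zh y0 yh.
  have h2 : e * z <= e * L by rewrite ler_pM2l.
  lra.
have [ydz|zyd] := leP (y + d) z.
  have h1 := overpriced_le i z0 zh y0 yh (gapE y0 ydz zh).
  have h2 : e * Num.max 0 (r z) <= e * L.
    by rewrite ler_pM2l// ge_max (ltW L_gt0) r_le.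
  rewrite -/r in h1; lra.
have h1 := overpriced_le_half i y0 yz zh.
have LL2 : 0 < Lam / 2 by have := Lam_gt0; lra.
have fyL : f y * (Lam / 2) <= f L * (Lam / 2).
  by rewrite ler_pM2r// f_noninc//; lra.
have fy0 : 0 <= f y * (Lam / 2) by rewrite mulr_ge0 ?(ltW LL2)// ltW// f_gt0.
have h2 : z * (f y * (Lam / 2)) <= (y + d) * (f L * (Lam / 2)).
  by apply: ler_pM => //; exact: ltW.
have theta : 0 < e - f L * (Lam / 2) by have := fL; lra.
have h3 : (e - f L * (Lam / 2)) * L <= (e - f L * (Lam / 2)) * y.
  by rewrite ler_pM2l//; lra.
have := small2; lra.
Qed.

Lemma edgeworth_cycle : eps_equilibrium_cycle phih M eps L Rr.
Proof.
have d0 := d_gt0; have e0 := eps_gt0; have L0 := L_gt0; have de := d_eps.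
have rh := Rh; have lr := LR.
have itvE y : `[L + eps, Rr - eps]%classic y -> L + eps <= y /\ y <= Rr - eps.
  by rewrite /= in_itv /= => /andP[].
have outside y z : L + eps <= y -> y <= Rr - eps -> prices phih z ->
    ~ `[L - eps, Rr + eps]%classic z -> [/\ 0 <= z, z <= phih & (y <= z) || (z <= L)].
  move=> Ly yR /pricesE/andP[z0 zh] /negP nz; split=> //.
  by move: nz; rewrite in_itv /= negb_and -!ltNge => /orP[|] h;
    apply/orP; [right|left]; lra.
have itv' y : L + eps <= y -> y <= Rr - eps -> `[L, Rr]%classic (y - d).
  by move=> Ly yR; rewrite /= in_itv /=; apply/andP; split; lra.
split; first by split=> //; exact: ltW.
split.
- move=> i y /itvE[Ly yR]; exists (y - d); split; first exact: itv'.
  by move=> z pz nz; have [z0 zh zc] := outside y z Ly yR pz nz; exact: undercut_beats.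
- move=> s sin.
  (* The platform with the higher price deviates, its own price being among those beaten. *)
  have [i si] : exists i, s (other i) <= s i.
    have [h|h] := leP (s platform1) (s platform2); first by exists platform2.
    by exists platform1; exact: ltW.
  have [Ly yR] := itvE _ (sin (other i)); have [Lx xR] := itvE _ (sin i).
  exists i, (s (other i) - d); split; first exact: itv'.
    by apply: undercut_beats => //; rewrite ?si//; lra.
  by move=> z pz nz; have [z0 zh zc] := outside _ z Ly yR pz nz; exact: undercut_beats.
(* Against [c] itself, the reply [c - d] lies outside [[c, t]] yet beats every price from [c] on, so
   no reply in [[c, t]] can beat it. *)
- move=> [c [t [ct sub ci _]]].
  have cin : `[c, t]%classic c by rewrite /= in_itv /= lexx.
  have [Ly yR] := itvE _ (sub _ cin).
  have c0 : `[c + 0, t - 0]%classic c by rewrite addr0 subr0.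
  have [x [xin beats]] := ci platform1 c c0.
  have [_ xR] := itvE _ (sub _ xin); move: xin; rewrite /= in_itv /= => /andP[cx xt].
  have cd : prices phih (c - d) by apply/pricesE/andP; split; lra.
  have ncd : ~ `[c - 0, t + 0]%classic (c - d).
    by rewrite /= in_itv /= subr0 => /andP[h _]; lra.
  have h1 := beats _ cd ncd.
  have h2 : own M platform1 x c < own M platform1 (c - d) c.
    by apply: undercut_beats; rewrite ?cx//; lra.
  by move: (lt_trans h1 h2); rewrite ltxx.
Qed.

End Cycle.

Section Mixed.
(** [K] is the payoff lost through a shift of [d] in the indifference relation. It enters once in
    the equilibrium payoff and once in the deviation payoff, hence [2 * K] in [small]; [err_le] and
    [low_ge0] keep the minorants nonnegative. *)
Let K := e * (phih / (L - r L) * d).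
Hypotheses (rR : r Rr = L)
  (r_nondecr : forall x y, 0 <= x -> x <= y -> y <= Rr -> r x <= r y)
  (f_meas : measurable_fun (`[L, Rr]%classic : set (measurableTypeR R)) f)
  (d_le : d <= Rr - L) (err_le : err <= e * r L) (low_ge0 : K + err <= e * L)
  (small : 2 * K + e * d + 2 * err <= eps).

Let F := edgeworth_cdf f Lam e L.

Variable s : probability (measurableTypeR R) R.
Hypotheses (sLR : s `[L, Rr]%classic = 1%E)
  (sF : forall x, L <= x <= Rr -> s `[L, x]%classic = (F x)%:E).

Let in_prices x : L <= x -> x <= Rr -> 0 <= x /\ x <= phih.
Proof. by move=> Lx xR; have L0 := L_gt0; have rh := Rh; split; lra. Qed.

Let fLam x : L <= x -> x <= Rr -> e <= Lam * f x /\ Lam * f x <= 2 * e.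
Proof.
move=> Lx xR; have [x0 xh] := in_prices Lx xR; split.
  by apply: le_trans (ltW fR) _; rewrite ler_pM2l// f_noninc.
by apply: le_trans (ltW fL); rewrite ler_pM2l// f_noninc// ltW.
Qed.

Let B_ge0 x : L <= x <= Rr -> 0 <= e * r x - err.
Proof.
move=> /andP[Lx xR]; rewrite subr_ge0 (le_trans err_le)// ler_pM2l//.
by rewrite r_nondecr// ltW.
Qed.

Let r_le_id x : L <= x -> x <= Rr -> r x <= x.
Proof.
move=> Lx xR; have [x0 xh] := in_prices Lx xR; have [_ f2] := fLam Lx xR.
rewrite -(ler_pM2l e_gt0) /r residualM// mulrC ler_wpM2r//; lra.
Qed.

Let A_ge0 x : L <= x <= Rr -> 0 <= e * x - err.
Proof.
move=> xLR; apply: le_trans (B_ge0 xLR) _; rewrite lerD2r ler_pM2l//.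
by case/andP: xLR; exact: r_le_id.
Qed.

Let low_le x : L <= x <= Rr -> exists2 p : R,
  s `[L, Num.min (x + d) Rr]%classic = p%:E &
  e * L - K - err <= (e * x - err) * (1 - p) + (e * r x - err) * p.
Proof.
move=> /andP[Lx xR]; have d0 := d_gt0; set w := Num.min _ _.
have Lw : L <= w by rewrite le_min (ltW LR) andbT; lra.
have wR : w <= Rr by rewrite ge_min lexx orbT.
have xw : x <= w by rewrite le_min xR andbT; lra.
have wd : `|w - x| <= d.
  rewrite ger0_norm ?subr_ge0// lerBlDr addrC ge_min lexx//.
exists (F w); first by rewrite sF// Lw.
have := edgeworth_indifference Lam_gt0 e_gt0 L_gt0 LR Rh f_noninc fL fR r_le
  r_nondecr Lx xR Lw wR (ltW d0) wd.
rewrite -/F -/r -(ler_pM2l e_gt0) -/K -{1}(gtr0_norm e_gt0) -normrM.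
move=> /ler_normlP[+ _]; lra.
Qed.

Let mixed_payoff_ge i : ((e * L - K - err)%:E <= mixed_payoff phih M i (fun=> s))%E.
Proof.
pose ILR : set (measurableTypeR R) := `[L, Rr]%classic.
have cst_meas (c : R) : measurable_fun ILR (fun=> c : R).
  exact: measurable_cst.
have id_meas : measurable_fun ILR (fun x : R => x).
  exact: (@measurable_id _ (measurableTypeR R)).
have mA : measurable_fun ILR (fun x => e * x - err).
  by apply: measurable_funB => //; apply: measurable_funM.
have mB : measurable_fun ILR (fun x => e * r x - err).
  apply: measurable_funB => //; apply: measurable_funM => //.
  apply: measurable_funM => //; apply: measurable_funM => //.
  exact: measurable_funB.
have c0 : 0 <= e * L - K - err by have := low_ge0; lra.
have sub : `[L, Rr]%classic `<=` prices phih.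
  move=> x; rewrite /= in_itv /= => /andP[Lx xR].
  by have [x0 xh] := in_prices Lx xR; apply/pricesE; rewrite x0.
have h0 x y : prices phih x -> prices phih y -> 0 <= own M i x y.
  by move=> /pricesE/andP[x0 xh] /pricesE/andP[y0 yh]; exact: payoff_ge0.
have hA x y : L <= x <= Rr -> L <= y <= Rr -> x + d < y -> e * x - err <= own M i x y.
  move=> /andP[Lx xR] /andP[Ly yR] xy.
  have [x0 xh] := in_prices Lx xR; have [y0 yh] := in_prices Ly yR.
  apply: undercut_ge => //; first by have [] := fLam Lx xR.
  exact: gapE (ltW xy) yh.
have hB x y : L <= x <= Rr -> L <= y <= Rr -> y <= x + d -> e * r x - err <= own M i x y.
  move=> /andP[Lx xR] /andP[Ly yR] _.
  have [x0 xh] := in_prices Lx xR; have [y0 yh] := in_prices Ly yR.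
  by apply: payoff_ge_residual => //; have [] := fLam Lx xR.
rewrite /mixed_payoff; case: i h0 hA hB => h0 hA hB.
  exact: (double_integral_ge1 (ltW LR) (ltW d_gt0) c0 sLR sub mA mB
    A_ge0 B_ge0 h0 hA hB low_le).
exact: (double_integral_ge2 (ltW LR) (ltW d_gt0) c0 sLR sub mA mB
  A_ge0 B_ge0 h0 hA hB low_le).
Qed.

Let deviation_le i x : 0 <= x -> x <= phih ->
  (deviation_payoff phih M i x s <= (e * L + K + e * d + err)%:E)%E.
Proof.
move=> x0 xh; have err0 := err_ge0 phih_ge0.
have ed : 0 < e * d by rewrite mulr_gt0.
have K0 : 0 <= K.
  have qL : 0 <= L - r L by rewrite subr_ge0 r_le_id// ltW.
  by rewrite /K !mulr_ge0 ?(ltW e_gt0) ?(ltW d_gt0)// invr_ge0.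
have hK y : prices phih y -> 0 <= own M i x y <= e * x.
  by move=> /pricesE/andP[y0 yh]; rewrite payoff_ge0//= payoff_le.
have ex0 : 0 <= e * x by rewrite mulr_ge0// ltW.
(* Below [L + d] the crude bound [e x] is enough; this is the source of the term [e d]. *)
have [xL|Lx] := leP x (L + d).
  have sL : s `[L, Rr]%classic = 1%:E by [].
  apply: le_trans (integral_le_step (ltW LR) (lexx Rr) sLR sL ex0 ex0 ex0 hK _ _) _.
  - by move=> y /hK/andP[].
  - by move=> y /hK/andP[].
  have h : e * x <= e * (L + d) by rewrite ler_pM2l.
  rewrite lee_fin; lra.
pose w := Num.min x Rr - d.
have d0 := d_gt0; have dl := d_le.
have Lw : L <= w by rewrite /w lerBrDr le_min (ltW Lx) /=; lra.
have wR : w <= Rr.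
  by rewrite /w lerBlDr (@le_trans _ _ Rr)// ?ge_min ?lexx ?orbT// lerDl ltW.
have sw : s `[L, w]%classic = (F w)%:E by rewrite sF// Lw.
have B0 : 0 <= e * Num.max 0 (r x) + err.
  by rewrite addr_ge0// mulr_ge0 ?(ltW e_gt0)// le_max lexx.
apply: le_trans (integral_le_step Lw wR sLR sw B0 ex0 ex0 hK _ _) _.
- move=> y /pricesE/andP[y0 yh] /andP[Ly yw]; apply: overpriced_le => //.
  apply: gapE => //; move: yw; rewrite /w lerBrDr le_min => /andP[]//.
- by move=> y /hK/andP[].
rewrite lee_fin.
have := edgeworth_deviation Lam_gt0 e_gt0 L_gt0 LR Rh f_noninc fL fR rR r_le r_nondecr
  (erefl w) x0 xh d0 dl (ltW Lx) err0.
rewrite -/r -/F -/K; lra.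
Qed.

Lemma edgeworth_mixed_equilibrium : mixed_eps_nash phih M eps (fun=> s).
Proof.
split=> [i|i x /pricesE/andP[x0 xh]].
  rewrite /mixed_strategy; apply/eqP; rewrite eq_le probability_le1 /=; last first.
    exact: measurable_itvR.
  rewrite -sLR; apply: le_measure; rewrite ?inE; try exact: measurable_itvR.
  move=> x; rewrite /prices /= !in_itv /= => /andP[Lx xR].
  by have [-> ->] := in_prices Lx xR.
apply: le_trans (deviation_le i x0 xh) _.
apply: le_trans (leeD2r _ (mixed_payoff_ge i)).
by rewrite -EFinD lee_fin; have := small; lra.
Qed.

End Mixed.
End Edgeworth.
End Equilibria.
End Duopoly.

(** * Choice of the tolerances and conclusion *)

Lemma fluid_regime (R : realType) (phih Lam e c eta : R) :
  0 < phih -> 0 < Lam -> 0 < e -> 0 < c -> 0 < eta ->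
  exists abar bbar delta, [/\ 0 < abar, 0 < bbar, 0 < delta &
    forall alpha beta, 0 < alpha <= abar -> 0 < beta <= bbar ->
    [/\ alpha + delta < c, phih * ((alpha + delta) * Lam + delta * e) <= eta,
      (forall t, 0 <= t <= e -> idle e beta t <= delta) &
      (forall t, e <= t -> t * idle e beta t <= t - e + delta * e)]].
Proof.
move=> h0 Lam0 e0 c0 eta0.
have w0 : 0 < phih * (2 * Lam + e) by rewrite mulr_gt0// addr_gt0// mulr_gt0.
(* [tau] serves both as the bound on [alpha] and as [delta]: then [alpha + delta <= c / 2], and the
   error is at most [tau * phih * (2 Lam + e)]. *)
pose tau := Num.min (c / 4) (eta / (phih * (2 * Lam + e))).
have tau0 : 0 < tau by rewrite lt_min !divr_gt0.
have tauc : tau <= c / 4 by rewrite ge_min lexx.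
have taueta : tau * (phih * (2 * Lam + e)) <= eta.
  by rewrite -ler_pdivlMr// ge_min lexx orbT.
have [bbar b0 H] := idle_fluid e0 tau0.
exists tau, bbar, tau; split=> // alpha beta /andP[a0 at_] bb.
have [H1 H2] := H beta bb; split=> //; first by lra.
apply: le_trans taueta; rewrite mulrCA ler_pM2l//.
have : alpha * Lam <= tau * Lam by rewrite ler_pM2r.
lra.
Qed.

Theorem theorem7 (R : realType) (phih : R) (f : R -> R) (Lam e : R) (Nbar : nat)
    (phih_gt0 : 0 < phih)
    (f_concave : strictly_concave_in `[0, phih] f)
    (f_decr : {in `[0, phih] &, {homo f : x y /~ x < y}})
    (f_derivable : forall x : R, x \in `[0, phih] -> derivable_in `[0, phih] f x)
    (f_range : forall x : R, x \in `[0, phih] -> 0 < f x <= 1)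
    (f0 : f 0 = 1)
    (Lam_gt0 : 0 < Lam) (e_gt0 : 0 < e) (Nbar_gt0 : (0 < Nbar)%N)
    (rho := e / Lam)
    (rho_lt1 : rho < 1) :
  forall eps : R, 0 < eps ->
  exists alphabar betabar : R, [/\ 0 < alphabar, 0 < betabar &
  forall alpha beta : R,
    0 < alpha <= alphabar -> alpha < 1 -> 0 < beta <= betabar ->
    let M := calM f Lam e Nbar beta alpha in
    let phib := phi_b phih f in
    let phiL := phi_L phih f Lam e in
    let phiR := phi_R phih f Lam e in
    [/\ rho <= f phib / 2 ->
          pure_eps_nash phih M eps (fun=> ext_inverse phih f (2 * rho)),
        f phib / 2 < rho < 1 ->
          (exists sigma, is_sigma_star phih f Lam e sigma) /\
          (forall sigma, is_sigma_star phih f Lam e sigma ->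
             mixed_eps_nash phih M eps (fun=> sigma)) &
        f phib / 2 < rho < 1 ->
          eps_equilibrium_cycle phih M eps phiL phiR]].
Proof.
move=> eps eps0.
have inE' x : 0 <= x -> x <= phih -> x \in `[0, phih] by rewrite in_itv /= => -> ->.
have fd x y : 0 <= x -> x < y -> y <= phih -> f y < f x.
  by move=> x0 xy yh; apply: f_decr; rewrite ?inE'//; lra.
have fp x : 0 <= x -> x <= phih -> 0 < f x.
  by move=> x0 xh; have /andP[] := f_range x (inE' x x0 xh).
have fc a b c : 0 <= a -> a <= b -> b <= c -> c <= phih ->
    (c - b) * f a + (b - a) * f c <= (c - a) * f b.
  move=> a0; rewrite le_eqVlt => /orP[/eqP <-|ab]; first by rewrite subrr mul0r addr0.
  rewrite le_eqVlt => /orP[/eqP <-|bc] ch; first by rewrite subrr mul0r add0r.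
  have ca : 0 < c - a by lra.
  have t01 : 0 < (c - b) / (c - a) < 1.
    apply/andP; split; last by rewrite ltr_pdivrMr//; lra.
    by rewrite divr_gt0//; lra.
  have ia : `[0, phih]%classic a by rewrite /= in_itv /= a0; lra.
  have ic : `[0, phih]%classic c by rewrite /= in_itv /= ch andbT; lra.
  have ac : a != c by rewrite lt_eqF// (lt_trans ab).
  have := f_concave a c _ ia ic ac t01.
  have -> : (c - b) / (c - a) * a + (1 - (c - b) / (c - a)) * c = b.
    by field; rewrite gt_eqF.
  have -> : (c - b) / (c - a) * f a + (1 - (c - b) / (c - a)) * f c
      = ((c - b) * f a + (b - a) * f c) / (c - a).
    by field; rewrite gt_eqF.
  by rewrite ltr_pdivrMr// mulrC => /ltW; rewrite mulrC (mulrC (f b)).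
have fder x : 0 <= x -> x <= phih -> derivable_in `[0, phih] f x.
  by move=> x0 xh; apply: f_derivable; exact: inE'.
have fn := f_noninc fd; have f1 := f_le1 fd f0.
have fg := f_gap fc fd f0.
have rho0 : 0 < rho by rewrite divr_gt0.
have LrhoE : Lam * rho = e by rewrite /rho mulrC divfK ?gt_eqF.
have queue alpha beta : 0 < alpha -> alpha < 1 -> 0 < beta ->
    let U := idle e beta in let G := score e beta alpha Nbar in
    [/\ forall t, 0 <= t -> 0 <= U t, forall t, 0 <= t -> U t <= G t,
      forall t, 0 <= t -> G t <= U t + alpha, forall t, 0 <= t -> G t <= 1 &
      forall s t, 0 <= s -> s < t -> G s < G t].
  move=> a0 a1 b0 U G; split=> [t t0|t t0|t t0|t t0|s t s0 st].
  - exact/ltW/idle_gt0.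
  - exact: idle_le_score.
  - exact: score_le_idle.
  - exact: score_le1.
  - exact: score_incr.
have [fb|fb] := leP rho (f (phi_b phih f) / 2).
  (* Half of [eps] goes to [e d], the other half to [2 err] with [err <= eps / 4]. *)
  pose d := Num.min phih (eps / (2 * e)).
  have d0 : 0 < d by rewrite lt_min phih_gt0 divr_gt0// mulr_gt0.
  have dh : d <= phih by rewrite ge_min lexx.
  have de : d * (2 * e) <= eps by rewrite -ler_pdivlMr ?mulr_gt0// ge_min lexx orbT.
  have eps4 : 0 < eps / 4 by rewrite divr_gt0.
  have [abar [bbar [delta [a0 b0 dl0 H]]]] :=
    fluid_regime phih_gt0 Lam_gt0 e_gt0 (f_gap_gt0 fd f0 d0 dh) eps4.
  exists abar, bbar; split=> // alpha beta aP a1 bP M phib phiL phiR.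
  have [gapP errP idP1 idP2] := H alpha beta aP bP.
  have /andP[al0 _] := aP; have /andP[be0 _] := bP.
  split=> [_|/andP[]|/andP[]]; try by rewrite ltNge fb.
  have /andP[phib0 phibh] := phi_b_in phih_gt0 fc fd fp f0 fder.
  have small : e * d + 2 * (phih * ((alpha + delta) * Lam + delta * e)) <= eps by lra.
  have rho2 : 2 * rho <= 1 by have := f1 _ phib0 phibh; lra.
  pose p := ext_inverse phih f (2 * rho).
  have [pin fpE rp] : [/\ 0 <= p <= phih, 2 * e <= Lam * f p &
      forall x, p < x -> x <= phih -> residual f Lam e x <= p].
    (* If [2 rho < f phih], then [p = phih] and no price lies beyond it. Otherwise
       [2 rho <= f phib <= 1] excludes the default 0 of [ext_inverse]. *)
    rewrite /p /ext_inverse; case: ltP => [fph|fph].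
      rewrite lexx ltW//; split=> // [|x hx xh]; last by move: hx; rewrite ltNge xh.
      by rewrite -LrhoE mulrCA ler_pM2l// ltW.
    rewrite rho2; set z := xget _ _.
    have [zin fz] : `[0, phih]%classic z /\ f z = 2 * rho.
      apply: (@xgetPex _ 0 [set x | `[0, phih]%classic x /\ f x = 2 * rho]).
      have [c ch fcE] : exists2 c, c \in `[0, phih] & f c = 2 * rho.
        apply: IVT (ltW phih_gt0) (f_within fder) _.
        by rewrite f0 ge_min le_max fph rho2 orbT.
      by exists c.
    move: zin; rewrite /= in_itv /= => zin; split=> // [|x zx xh].
      by rewrite fz -LrhoE mulrCA.
    have /andP[z0 zh] := zin.
    apply: (residual_after_phi_b phih_gt0 fc fd fp f0 fder) => //.
    rewrite leNgt; apply/negP => zb; have := fd _ _ z0 zb phibh.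
    by rewrite fz; lra.
  have [U0 UG GU G1 Gi] := queue alpha beta al0 a1 be0.
  apply: (@pure_equilibrium R phih f Lam e alpha delta (idle e beta)
    (score e beta alpha Nbar) M) pin fpE rp small => //.
  - by move=> t t0; exact: served_le.
  - by move=> i x y; exact: own_split.
have [LR fRrho fLrho _] := edgeworth phih_gt0 fc fd fp f0 fder Lam_gt0 e_gt0 rho_lt1 fb.
have L0 := phi_L_gt0 phih_gt0 f0 fder Lam_gt0 e_gt0 rho_lt1.
have [R0 Rh _] := phi_RP phih_gt0 fder Lam e.
have LE := phi_LE phih_gt0 fder Lam e.
have rle := residual_le_L phih_gt0 fder Lam e.
have rnd := residual_nondecr phih_gt0 fc fd fder Lam_gt0 e_gt0.
move: LR fRrho fLrho L0 R0 Rh LE rle rnd.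
set L := phi_L phih f Lam e; set Rr := phi_R phih f Lam e.
move=> LR fRrho fLrho L0 R0 Rh LE rle rnd.
have fL : Lam * f L < 2 * e by rewrite -LrhoE mulrCA ltr_pM2l.
have fR : e < Lam * f Rr by rewrite -LrhoE ltr_pM2l.
have rR : residual f Lam e Rr = L by [].
have rL0 := residual_gt0 Lam_gt0 e_gt0 L0 Rh fn fR (lexx L) (ltW LR).
have F_lip := edgeworth_cdf_lipschitz Lam_gt0 e_gt0 L0 LR Rh fn fL rle (rnd).
have FL : edgeworth_cdf f Lam e L L = 0 by exact: edgeworth_cdfL.
have q0 : 0 < L - residual f Lam e L.
  rewrite -(pmulr_rgt0 _ e_gt0) mulrBr residualM//.
  have : 0 < L * (2 * e - Lam * f L) by rewrite mulr_gt0// subr_gt0.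
  lra.
have FR : edgeworth_cdf f Lam e L Rr = 1 by apply: edgeworth_cdfR.
(* Numerator and denominator are [e] times those of [edgeworth_cdf], because
   [Lam f(Rr) Rr - e Rr = e r(Rr) = e L]. *)
have sigmaE x : (e * (x + Rr) - Lam * f Rr * Rr) / (2 * e * x - Lam * f x * x)
    = edgeworth_cdf f Lam e L x.
  have -> : e * (x + Rr) - Lam * f Rr * Rr = e * (x - L).
    by rewrite -rR mulrBr residualM//; ring.
  have -> : 2 * e * x - Lam * f x * x = e * (x - residual f Lam e x).
    by rewrite mulrBr residualM//; ring.
  by rewrite -mulf_div divff ?mul1r// gt_eqF.
have e2 : 0 < e * eps by rewrite mulr_gt0.
have theta : 0 < (e - f L * (Lam / 2)) * L by rewrite mulr_gt0//; lra.
have eL : 0 < e * L by rewrite mulr_gt0.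
have erL : 0 < e * residual f Lam e L by rewrite mulr_gt0.
pose k := e * (phih / (L - residual f Lam e L)).
have k0 : 0 < k by rewrite mulr_gt0// divr_gt0.
(* With [k d = K], the bounds give [2 K <= eps / 4], [e d <= eps / 4] and [K <= e L / 2]. The bound
   with [8 * e] leaves an eighth of the margin of [small2] to each of its two [d] terms, since
   [f L Lam / 2 < e]. *)
have [d [d0 dh deps dLR [d_theta dkL dkeps de]]] : exists d, [/\ 0 < d, d <= phih,
    d <= eps / 2, d <= Rr - L &
    [/\ d * (8 * e) <= (e - f L * (Lam / 2)) * L, d * (2 * k) <= e * L,
      d * (8 * k) <= eps & d * (4 * e) <= eps]].
  exists (Num.min phih (Num.min (eps / 2) (Num.min (Rr - L)
    (Num.min ((e - f L * (Lam / 2)) * L / (8 * e)) (Num.min (e * L / (2 * k))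
    (Num.min (eps / (8 * k)) (eps / (4 * e)))))))).
  have [e8 e4] : 0 < 8 * e /\ 0 < 4 * e by split; rewrite mulr_gt0.
  have [k2 k8] : 0 < 2 * k /\ 0 < 8 * k by split; rewrite mulr_gt0.
  split; last split; rewrite -?ler_pdivlMr ?ge_min ?lexx ?orbT//.
  by rewrite !lt_min phih_gt0 subr_gt0 LR !divr_gt0.
have [eta [eta0 eta1 eta2 eta3 [eta4 eta5]]] : exists eta, [/\ 0 < eta,
    eta <= e * eps / 8, eta <= (e - f L * (Lam / 2)) * L / 4,
    eta <= e * residual f Lam e L & eta <= e * L / 2 /\ eta <= eps / 8].
  exists (Num.min (e * eps / 8) (Num.min ((e - f L * (Lam / 2)) * L / 4)
    (Num.min (e * residual f Lam e L) (Num.min (e * L / 2) (eps / 8))))).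
  by rewrite !lt_min !ge_min !lexx !orbT !divr_gt0// erL.
have [abar [bbar [delta [a0 b0 dl0 H]]]] :=
  fluid_regime phih_gt0 Lam_gt0 e_gt0 (f_gap_gt0 fd f0 d0 dh) eta0.
exists abar, bbar; split=> // alpha beta aP a1 bP M phib phiL phiR.
have [gapP errP idP1 idP2] := H alpha beta aP bP.
have /andP[al0 _] := aP; have /andP[be0 _] := bP.
have [U0 UG GU G1 Gi] := queue alpha beta al0 a1 be0.
have served t : 0 <= t -> t * (1 - idle e beta t) <= e by exact: served_le.
have split_ i x y : 0 <= x -> x <= phih -> 0 <= y -> y <= phih -> _ :=
  own_split (N := Nbar) Lam_gt0 e_gt0 be0 al0 a1 Nbar_gt0 fp f1 i (x := x) (y := y).
have fg' x y c : 0 <= y -> 0 <= c -> y + c <= x -> x <= phih -> 1 - f c <= f y - f x.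
  exact: fg.
have de' : d < eps by lra.
split=> [|_|_]; first by rewrite leNgt fb.
- split.
    have F_lip' x y : L <= x -> x <= y -> y <= Rr -> 0 <= edgeworth_cdf f Lam e L y -
        edgeworth_cdf f Lam e L x <= (L - residual f Lam e L)^-1 * (y - x).
      exact: F_lip.
    have [s [s1 sF]] := exists_probability_of_cdf LR F_lip' FL FR.
    exists s; split=> // x; rewrite /= in_itv /= => xLR.
    by rewrite -/L -/Rr sigmaE sF.
  move=> s [s1 sF].
  have f_meas : measurable_fun (`[L, Rr]%classic : set (measurableTypeR R)) f.
    apply: subspace_continuous_measurable_fun; first exact: measurable_itvR.
    apply: continuous_subspaceW (f_within fder).
    by apply: subset_itv; rewrite bnd_simp// ltW.
  apply: (@edgeworth_mixed_equilibrium R phih f Lam e alpha delta (idle e beta)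
    (score e beta alpha Nbar) M _ _ _ _ _ _ _ _ _ _ _ _ _ _ _ d eps _ _ _ L Rr) => //.
  + exact: le_trans eta3.
  + have : d * (2 * k) <= e * L by []. rewrite /k; lra.
  + rewrite /k in dkeps; lra.
  + by move=> x xLR; rewrite sF ?sigmaE// /= in_itv.
- apply: (@edgeworth_cycle R phih f Lam e alpha delta (idle e beta)
    (score e beta alpha Nbar) M _ _ _ _ _ _ _ _ _ _ _ _ _ _ _ _ d eps) => //.
  + have : e * d <= e * (eps / 2) by rewrite ler_pM2l.
    move: errP; set err := phih * _; lra.
  + have : d * (f L * (Lam / 2)) <= d * e by rewrite ler_pM2l//; lra.
    move: errP eta2 d_theta theta; set err := phih * _; set Q := (e - _) * L.
    move: (d * (f L * _)) => dT; clearbody Q err. lra.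
Qed.
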